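(* Let $d\in\mathbb{Z}$ with $d>1$, let $q=1/d$, and let $\sigma_d=\tau_q$ be the automorphism of $Q(\mathcal{C})$ given by $\tau_q(a/b)=\tau_q(a)/\tau_q(b)$ for $a,b\in\mathcal{C}$, $b\neq0$, where $\tau_q\{a(t)\}=\{q\,a(qt)\}$ on $\mathcal{C}$. Let $D'=-h^{-1}\frac{d}{ds}$. For every $\sum_{n=0}^\infty\alpha_nh^n\in\mathbb{C}[[h]]$ (with $\alpha_n\in\mathbb{C}$), $$\sigma_d\left(\sum_{n=0}^\infty\alpha_nh^n\right)=\sum_{n=0}^\infty\alpha_nh^{dn},\qquad D'\left(\sum_{n=0}^\infty\alpha_nh^n\right)=\sum_{n=1}^\infty n\alpha_nh^{n-1}.$$ Hence $\mathbb{C}[[h]]$ is a DT subring of $(Q(\mathcal{C}),D',\sigma_d)$, and its quotient field $\mathbb{C}((h))$ is a DT subfield.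
   Context: $\mathcal{C}$ is the set of complex-valued continuous functions on $[0,\infty)$; $f\in\mathcal{C}$ is written $\{f(t)\}$. It is a commutative ring without identity under pointwise addition and the convolution product $\{f(t)\}\{g(t)\}=\{\int_0^t f(t-u)g(u)\,du\}$. By Titchmarsh's theorem it has no zero divisors, and $Q(\mathcal{C})$ denotes its field of fractions; $a\in\mathcal{C}$ is identified with $ab/b$ for any nonzero $b\in\mathcal{C}$. A complex number $\alpha$ is identified with $\{\alpha\}/\{1\}\in Q(\mathcal{C})$, which makes $\mathbb{C}$ a subfield of $Q(\mathcal{C})$. Put $l=\{1\}\in\mathcal{C}$ (the constant function $1$) and $s=1/l\in Q(\mathcal{C})$. For $\lambda\geq 0$ let $H_\lambda(t)=0$ for $0\le t\le\lambda$ and $H_\lambda(t)=1$ for $t>\lambda$. The translation operator is $h^\lambda=s\cdot\dfrac{\{\int_0^tH_\lambda(u)\,du\}}{l}\in Q(\mathcal{C})$. One has $h^0=1$, $h^\lambda h^\mu=h^{\lambda+\mu}$, and $h$ denotes $h^1$. Convergence in $Q(\mathcal{C})$: a sequence $(a_n)$ in $Q(\mathcal{C})$ converges if there is $p\in Q(\mathcal{C})$, $p\ne0$, such that all $a_n/p$ lie in $\mathcal{C}$ and converge uniformly on every finite interval; the limit is $p\lim_n(a_n/p)$, and it is unique. Series are limits of partial sums. For arbitrary $\alpha_n\in\mathbb{C}$ the series $\sum_{n=0}^\infty\alpha_nh^n$ converges in $Q(\mathcal{C})$, and $\mathbb{C}[[h]]=\{\sum_{n=0}^\infty\alpha_nh^n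 : \alpha_n\in\mathbb{C}\}\subset Q(\mathcal{C})$, a subring of $Q(\mathcal{C})$; $\mathbb{C}((h))\subset Q(\mathcal{C})$ is its quotient field. The derivation $\frac{d}{ds}$ of $Q(\mathcal{C})$ is the unique extension, by the quotient rule, of the map $\{a(t)\}\mapsto\{-t\,a(t)\}$ on $\mathcal{C}$. A DT ring (field) is a ring (field) equipped with a derivation and a transforming operator (an injective endomorphism); a DT subring (subfield) is a subring (subfield) mapped into itself by both, with the restricted maps. *)

(* Defs.v *)
From HB Require Import structures.
From mathcomp Require Import all_boot all_order all_algebra.
From mathcomp Require Import complex.
From mathcomp Require Import all_classical all_reals all_analysis.
From mathcomp Require Import measurable_realfun ring lra.

Import Order.TTheory GRing.Theory Num.Theory.
Import numFieldNormedType.Exports.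

Local Open Scope classical_set_scope.
Local Open Scope complex_scope.
Local Open Scope ring_scope.

(* R[i] is only declared as an algebra in real-closed; give it the topology of
   its modulus. *)
HB.instance Definition _ (R : rcfType) := NormedModule.copy R[i] R[i]^o.

(* A continuous function on [0, +oo[ is represented by its extension by 0 to
   the whole of R, so that equality of functions on [0, +oo[ is Leibniz
   equality in contC (lemma contC_eq). *)
Definition contC_pred {R : realType} : {pred R -> R[i]} :=
  fun f => `[< {within `[0, +oo[, continuous f} /\
               forall t, t < 0 -> f t = 0 >].

Lemma contC_zmod_closed (R : realType) : zmod_closed (@contC_pred R).
Proof.
split=> [|f g /asboolP[cf f0] /asboolP[cg g0]]; apply/asboolP; split.
- by move=> x; apply: cvg_cst.
- by [].
- by move=> x; apply: cvgB; [exact: cf | exact: cg].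
- by move=> t t0; rewrite !fctE f0 // g0 // subrr.
Qed.

HB.instance Definition _ (R : realType) :=
  GRing.isZmodClosed.Build (R -> R[i]) (@contC_pred R) (contC_zmod_closed R).

Record contC (R : realType) := ContC {
  contC_fun :> R -> R[i];
  contC_funP : contC_fun \in @contC_pred R }.
Arguments contC_funP {R}.

HB.instance Definition _ (R : realType) := [isSub for @contC_fun R].
HB.instance Definition _ (R : realType) := [Choice of contC R by <:].
HB.instance Definition _ (R : realType) :=
  [SubChoice_isSubZmodule of contC R by <:].

(* {f(t)}: the element of contC that agrees with f on [0, +oo[. It is the junk
   value 0 if f is not continuous on [0, +oo[; lemmas convolE, mulNtE, dilE and
   int_stepE show that this does not happen below. *)
Definition Cfun {R : realType} (f : R -> R[i]) : contC R :=
  insubd 0 (f \_ `[0, +oo[).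

Definition cintegral {R : realType} (A : set R) (f : R -> R[i]) : R[i] :=
  (\int[lebesgue_measure]_(u in A) complex.Re (f u))
  +i* (\int[lebesgue_measure]_(u in A) complex.Im (f u)).

Definition convol {R : realType} (f g : contC R) : contC R :=
  Cfun (fun t => cintegral `[0, t] (fun u => f (t - u) * g u)).

(* {a(t)} |-> {- t a(t)} *)
Definition mulNt {R : realType} (a : contC R) : contC R :=
  Cfun (fun t => - t%:C * a t).

(* {a(t)} |-> {q a(qt)} *)
Definition dil {R : realType} (q : R) (a : contC R) : contC R :=
  Cfun (fun t => q%:C * a (q * t)).

(* {\int_0^t H_lambda(u) du} *)
Definition int_step {R : realType} (lambda : R) : contC R :=
  Cfun (fun t => cintegral `[0, t] (fun u => if u <= lambda then 0 else 1)).

(* A field of fractions Q(C) of the ring (contC R, +, convol), which has no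
   unit; it is unique up to isomorphism, and exists by Titchmarsh's theorem. *)
Record fraction_field (R : realType) := FractionField {
  fraction_field_sort :> fieldType;
  inC : contC R -> fraction_field_sort;
  inCD : {morph inC : a b / a + b};
  inCM : {morph inC : a b / convol a b >-> a * b};
  inC_inj : injective inC;
  inC_frac : forall x, exists a b, b != 0 /\ x = inC a / inC b }.
Arguments inC {R Q} : rename.
Arguments inCD {R Q} : rename.
Arguments inCM {R Q} : rename.
Arguments inC_inj {R Q} : rename.
Arguments inC_frac {R Q} : rename.

Section Operators.
Context {R : realType} {Q : fraction_field R}.

Definition scalar_op (alpha : R[i]) : Q :=
  inC (Cfun (fun=> alpha)) / inC (Cfun (fun=> 1)).

Definition l_op : Q := inC (Cfun (fun=> 1)).

Definition s_op : Q := 1 / l_op.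

(* h^lambda *)
Definition transl (lambda : R) : Q := s_op * (inC (int_step lambda) / l_op).

(* The quotient rule on an arbitrarily chosen representative a/b; the result
   does not depend on that choice (lemma dds_frac). *)
Definition dds (x : Q) : Q := xget 0 [set y | exists a b,
  [/\ b != 0, x = inC a / inC b &
      y = (inC (mulNt a) * inC b - inC a * inC (mulNt b)) / inC b ^+ 2]].

(* For 0 < q the result does not depend on the representative (lemma
   tau_frac). *)
Definition tau (q : R) (x : Q) : Q := xget 0 [set y | exists a b,
  [/\ b != 0, x = inC a / inC b & y = inC (dil q a) / inC (dil q b)]].

(* x is the limit in Q(C) of the sequence u. *)
Definition Qcvg (u : nat -> Q) (x : Q) : Prop :=
  exists (p : Q) (f_ : nat -> contC R) (f : contC R),
  [/\ p != 0, forall n, u n / p = inC (f_ n),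
      forall T : R, {uniform `[0, T],
        (fun n => f_ n : R -> R[i]) @ \oo --> (f : R -> R[i])}
    & x = p * inC f].

(* x is the sum of u n over n >= m. *)
Definition Qsum (m : nat) (u : nat -> Q) (x : Q) : Prop :=
  Qcvg (fun N => \sum_(m <= n < N) u n) x.

End Operators.

(* C[[h]] *)
Definition series_ring {R : realType} (Q : fraction_field R) : set Q :=
  [set x | exists alpha : nat -> R[i],
    Qsum 0 (fun n => scalar_op (alpha n) * transl 1 ^+ n) x].

(* The quotient field, inside K, of a subring S of K. *)
Definition quotients {K : fieldType} (S : set K) : set K :=
  [set z | exists x y, [/\ S x, S y, y != 0 & z = x / y]].

(* (A, D, sigma) is a DT ring: D is a derivation of A and sigma an injective
   endomorphism of A. *)
Record DT_ring {A : nzRingType} (D sigma : A -> A) : Prop := {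
  DT_derivD : {morph D : x y / x + y};
  DT_derivM : forall x y, D (x * y) = D x * y + x * D y;
  DT_transD : {morph sigma : x y / x + y};
  DT_transM : {morph sigma : x y / x * y};
  DT_trans1 : sigma 1 = 1;
  DT_trans_inj : injective sigma }.

Definition DT_subring {A : nzRingType} (D sigma : A -> A) (S : set A) : Prop :=
  [/\ DT_ring D sigma, subring_closed [in S],
      forall x, S x -> S (D x) & forall x, S x -> S (sigma x)].

Definition DT_subfield {K : fieldType} (D sigma : K -> K) (S : set K) : Prop :=
  [/\ DT_ring D sigma, divring_closed [in S],
      forall x, S x -> S (D x) & forall x, S x -> S (sigma x)].

Section ContC.
Context {R : realType}.
Local Notation mu := (@lebesgue_measure R).
Local Notation Re := (@complex.Re R).
Local Notation Im := (@complex.Im R).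

Lemma normc_ge_Im (x : R[i]) : `|Im x|%:C <= `|x|.
Proof.
by case: x => a b; simpc; rewrite -sqrtr_sqr ler_wsqrtr // lerDr sqr_ge0.
Qed.

Lemma Re_continuous : continuous Re.
Proof.
move=> z; apply/(@cvgrPdist_lt _ _ _ (nbhs z)) => e e0.
have e0' : 0 < e%:C by rewrite ltcR.
apply: filterS (nbhsx_ballx z _ e0') => w zw.
rewrite -ltcR; apply: le_lt_trans (_ : `|z - w| < _); last exact: zw.
by rewrite -raddfB; apply: normc_ge_Re.
Qed.

Lemma Im_continuous : continuous Im.
Proof.
move=> z; apply/(@cvgrPdist_lt _ _ _ (nbhs z)) => e e0.
have e0' : 0 < e%:C by rewrite ltcR.
apply: filterS (nbhsx_ballx z _ e0') => w zw.
rewrite -ltcR; apply: le_lt_trans (_ : `|z - w| < _); last exact: zw.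
by rewrite -raddfB; apply: normc_ge_Im.
Qed.

Lemma RtoC_continuous : continuous (real_complex R).
Proof.
move=> z; apply/(@cvgrPdist_lt _ _ _ (nbhs z)) => e e0.
have eR : (complex.Re e)%:C = e by apply: RRe_real; apply: gtr0_real.
have e0' : 0 < complex.Re e by rewrite -ltcR eR.
apply: filterS (nbhsx_ballx z _ e0') => w zw.
by rewrite -raddfB normc_def /= expr0n /= addr0 sqrtr_sqr -eR ltcR; exact: zw.
Qed.

Lemma cvg_complex (T : topologicalType) (F : set_system T) (FF : Filter F) (f g : T -> R) a b :
  f @ F --> a -> g @ F --> b -> (f x +i* g x) @[x --> F] --> a +i* b.
Proof.
move=> fa gb.
have -> : (fun x => f x +i* g x) = (fun x => (f x)%:C + 'i * (g x)%:C).
  by apply/funext => x; simpc.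
have -> : a +i* b = a%:C + 'i * b%:C by simpc.
apply: cvgD; first by apply: (cvg_comp _ _ fa); apply: RtoC_continuous.
apply: cvgM; first exact: cvg_cst.
by apply: (cvg_comp _ _ gb); apply: RtoC_continuous.
Qed.

Lemma continuous_complex (T : topologicalType) (f g : T -> R) : continuous f -> continuous g ->
  continuous (fun x => f x +i* g x).
Proof. by move=> cf cg x; apply: cvg_complex; [apply: cf|apply: cg]. Qed.

Lemma cont_integrable (f : R -> R) a b : continuous f -> mu.-integrable `[a, b] (EFin \o f).
Proof.
move=> cf; apply: continuous_compact_integrable; first exact: segment_compact.
exact: continuous_subspaceT.
Qed.

Lemma within0y (f : R -> R) : (forall T, 0 < T -> {within `[0, T], continuous f}) ->
  {within `[0, +oo[, continuous f}.
Proof.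
move=> cf; apply/continuous_within_itvcyP; split.
  move=> x; rewrite in_itv /= andbT => x0.
  have x1 : 0 < x + 1 by rewrite addr_gt0.
  have /(continuous_within_itvP _ x1)[H _ _] := cf _ x1.
  by apply: H; rewrite in_itv /= x0 ltrDl ltr01.
have /(continuous_within_itvP _ ltr01)[_ H _] := cf _ ltr01; exact: H.
Qed.

Lemma Rint_cont (f : R -> R) : (forall T, 0 < T -> mu.-integrable `[0, T] (EFin \o f)) ->
  {within `[0, +oo[, continuous (fun t => \int[mu]_(u in `[0, t]) f u)}.
Proof.
move=> intf; apply: within0y => T T0.
by apply: parameterized_integral_continuous; [exact: ltW|exact: intf].
Qed.

Lemma cont_bounded (f : R -> R) a b : continuous f ->
  exists M, forall x, x \in `[a, b] -> `|f x| <= M.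
Proof.
move=> cf.
have [ab|ba] := leP a b; last first.
  by exists 0 => x; rewrite in_itv /= => /andP[ax xb]; have := le_lt_trans (le_trans ax xb) ba; rewrite ltxx.
have cnf : {within `[a, b], continuous (fun x => `|f x|)}.
  by apply: continuous_subspaceT => x; apply: cvg_norm; apply: cf.
have [c _ Hc] := EVT_max ab cnf.
by exists `|f c| => x; apply: Hc.
Qed.

Lemma Rconv_cont (p q : R -> R) : continuous p -> continuous q ->
  {within `[0, +oo[, continuous (fun t => \int[mu]_(u in `[0, t]) (p (t - u) * q u))}.
Proof.
move=> cp cq; apply: within0y => T T0.
pose phi x := p (Num.max 0 x) - p 0.
have cphi : continuous phi.
  move=> x; apply: cvgB; last exact: cvg_cst.
  apply: (cvg_comp (fun x : R => Num.max 0 x) p); last exact: cp.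
  apply: (@continuous_max R R (cst 0) id x); [exact: cvg_cst|exact: cvg_id].
have cp2 (t : R) : continuous (fun u => p (t - u)).
  move=> u; apply: (cvg_comp (fun u : R => t - u) p); last exact: cp.
  by apply: cvgB; [exact: cvg_cst|exact: cvg_id].
have cphi2 (t : R) : continuous (fun u => phi (t - u)).
  move=> u; apply: (cvg_comp (fun u : R => t - u) phi); last exact: cphi.
  by apply: cvgB; [exact: cvg_cst|exact: cvg_id].
have cphiq (t : R) : continuous (fun u => phi (t - u) * q u).
  by move=> u; apply: cvgM; [exact: cphi2|exact: cq].
have E t : t \in `[0, T] -> p 0 * (\int[mu]_(u in `[0, t]) q u) +
      \int[mu]_(u in `[0, T]) (phi (t - u) * q u) =
    \int[mu]_(u in `[0, t]) (p (t - u) * q u).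
  rewrite in_itv /= => /andP[t0 tT].
  have UE : `[0, T]%classic = `[0, t]%classic `|` `]t, T]%classic :> set R.
    apply/seteqP; split=> u /=; rewrite !in_itv /=.
      by move=> /andP[u0 uT]; have [ut|tu] := leP u t; [left|right]; rewrite ?u0 ?uT.
    case=> /andP[u0 uT]; first by rewrite u0 (le_trans uT).
    by rewrite uT (le_trans t0 (ltW u0)).
  rewrite {1}UE Rintegral_setU //=; last 2 first.
  - by rewrite -UE; apply: cont_integrable.
  - apply/disj_setPS => u /= []; rewrite !in_itv /= => /andP[_ ut] /andP[tu _].
    by have := lt_le_trans tu ut; rewrite ltxx.
  rewrite [X in _ + (_ + X)](_ : _ = 0) ?addr0; last first.
    under eq_Rintegral.
      move=> u /set_mem /=; rewrite in_itv /= => /andP[tu _].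
      rewrite /phi (_ : Num.max 0 (t - u) = 0) ?subrr ?mul0r; last first.
        by apply/max_idPl; rewrite subr_le0 ltW.
      over.
    by rewrite Rintegral_cst ?mul0r //.
  rewrite -RintegralZl //; last exact: cont_integrable.
  rewrite -RintegralD //; last 2 first.
  - by apply: cont_integrable => u; apply: cvgM; [exact: cvg_cst|exact: cq].
  - exact: cont_integrable.
  apply: eq_Rintegral => u /set_mem /=; rewrite in_itv /= => /andP[_ ut].
  rewrite /phi (_ : Num.max 0 (t - u) = t - u); last by apply/max_idPr; rewrite subr_ge0.
  by rewrite -mulrDl addrC subrK.
pose G t := p 0 * (\int[mu]_(u in `[0, t]) q u) +
      \int[mu]_(u in `[0, T]) (phi (t - u) * q u).
suff cG : {within `[0, T], continuous G}.
  by refine (subspace_eq_continuous _ cG) => t /set_mem; apply: E.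
move=> t; apply: cvgD.
  apply: cvgM; first exact: cvg_cst.
  have /= := @parameterized_integral_continuous R 0 T q (ltW T0) (cont_integrable q 0 T cq).
  exact.
move: t; apply: continuous_subspaceW (_ : `[0, T] `<=` `](-1), (T + 1)[) _.
  move=> x /=; rewrite !in_itv /= => /andP[x0 xT]; apply/andP; split; lra.
apply: continuous_in_subspaceT.
have [M1 HM1] := cont_bounded phi (-1 - T) (T + 1) cphi.
have [M2 HM2] := cont_bounded q 0 T cq.
apply: (@continuity_under_integral R _ _ mu (fun t u => phi (t - u) * q u) `[0, T] _ (-1) (T + 1) _ _ (fun=> M1 * M2)) => //.
- by move=> x _; apply: cont_integrable.
- apply: aeW => u _ x _; apply: cvgM; last exact: cvg_cst.
  apply: (cvg_comp (fun x : R => x - u) phi); last exact: cphi.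
  by apply: cvgB; [exact: cvg_id|exact: cvg_cst].
- by apply: cont_integrable; exact: cst_continuous.
- move=> x; rewrite /= in_itv /= => /andP[x1 x2]; apply: aeW => u; rewrite /= in_itv /= => /andP[u0 uT].
  rewrite normrM ler_pM //; [apply: HM1|apply: HM2]; rewrite in_itv /= ?u0 ?uT //.
  apply/andP; split; lra.
Qed.

Lemma contC_within (a : contC R) : {within `[0, +oo[, continuous a}.
Proof. by case/asboolP: (contC_funP a). Qed.

Lemma contC_ext_continuous (a : contC R) : continuous (fun t : R => a (Num.max 0 t)).
Proof.
move=> t.
have M0 : 0 <= Num.max 0 t by rewrite le_max lexx.
have /subspace_continuousP /(_ (Num.max 0 t)) H := contC_within a.
have cM : {for t, continuous (fun x : R => Num.max 0 x)}.
  by apply: (@continuous_max R R (cst 0) id t); [exact: cvg_cst|exact: cvg_id].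
have cW : Num.max 0 x @[x --> t] --> within `[0, +oo[ (nbhs (Num.max 0 t)).
  move=> A wA.
  have FA : nbhs t [set x : R | `[0, +oo[%classic (Num.max 0 x) -> A (Num.max 0 x)] := cM _ wA.
  by apply: (@filterS _ (nbhs t) _ _ _ _ FA) => x; apply;
  rewrite /= in_itv /= le_max lexx.
by apply: (cvg_comp _ a cW); apply: H; rewrite /= in_itv /= M0.
Qed.

Lemma contC_eq (a b : contC R) : (forall t, 0 <= t -> a t = b t) -> a = b.
Proof.
move=> ab; apply/val_inj/funext => t /=.
have [t0|t0] := leP 0 t; first exact: ab.
case/asboolP: (contC_funP a) => _ ->//; by case/asboolP: (contC_funP b) => _ ->.
Qed.

Lemma CfunE (f : R -> R[i]) t : {within `[0, +oo[, continuous f} -> 0 <= t ->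
  Cfun f t = f t.
Proof.
move=> cf t0; rewrite /Cfun -[LHS]/(val _ t) insubdK; last first.
  apply/asboolP; split.
    refine (subspace_eq_continuous _ cf) => x xA.
    by rewrite /from_subspace patchE xA.
  by move=> x x0; rewrite patchE memNset //= in_itv /= andbT leNgt x0.
by rewrite patchE mem_set //= in_itv /= t0.
Qed.

Lemma eq_cintegral (A : set R) (f g : R -> R[i]) : {in A, f =1 g} ->
  cintegral A f = cintegral A g.
Proof. by move=> fg; congr Complex; apply: eq_Rintegral => u uA; rewrite fg. Qed.

Lemma Re_comp_cont (f : R -> R[i]) : continuous f -> continuous (Re \o f).
Proof. by move=> cf x; apply: (cvg_comp f Re (cf x)); apply: Re_continuous. Qed.
Lemma Im_comp_cont (f : R -> R[i]) : continuous f -> continuous (Im \o f).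
Proof. by move=> cf x; apply: (cvg_comp f Im (cf x)); apply: Im_continuous. Qed.

Lemma cintegralD a b (f g : R -> R[i]) : continuous f -> continuous g ->
  cintegral `[a, b] (fun u => f u + g u) = cintegral `[a, b] f + cintegral `[a, b] g.
Proof.
move=> cf cg; rewrite /cintegral; simpc; congr Complex.
  under eq_Rintegral do rewrite raddfD.
  by rewrite RintegralD //; apply: cont_integrable; exact: Re_comp_cont.
under eq_Rintegral do rewrite raddfD.
by rewrite RintegralD //; apply: cont_integrable; exact: Im_comp_cont.
Qed.

Let RCmulE (k x y : R) : k%:C * (x +i* y) = (k * x) +i* (k * y).
Proof. by simpc. Qed.

Lemma cintegralZ a b (k : R) (f : R -> R[i]) : continuous f ->
  cintegral `[a, b] (fun u => k%:C * f u) = k%:C * cintegral `[a, b] f.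
Proof.
move=> cf; rewrite /cintegral RCmulE; congr Complex.
  transitivity (\int[mu]_(u in `[a, b]) (k * Re (f u))).
    by apply: eq_Rintegral => u _; case: (f u) => ? ?; rewrite RCmulE.
  by rewrite RintegralZl //; apply: cont_integrable; exact: Re_comp_cont.
transitivity (\int[mu]_(u in `[a, b]) (k * Im (f u))).
    by apply: eq_Rintegral => u _; case: (f u) => ? ?; rewrite RCmulE.
by rewrite RintegralZl //; apply: cont_integrable; exact: Im_comp_cont.
Qed.

Lemma cintegral_dil (q t : R) (f : R -> R[i]) : 0 < q -> 0 <= t -> continuous f ->
  cintegral `[0, q * t] f = q%:C * cintegral `[0, t] (fun u => f (q * u)).
Proof.
move=> q0 t0 cf.
have cq : continuous (fun u : R => q * u).
  by move=> u; apply: cvgM; [exact: cvg_cst|exact: cvg_id].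
have key (p : R -> R) : continuous p ->
    \int[mu]_(u in `[0, q * t]) p u = q * \int[mu]_(u in `[0, t]) p (q * u).
  move=> cp.
  have dE : (fun x : R => q * x)^`()%classic = cst q.
    apply/funext => x; rewrite derive1E.
    have H : is_derive x 1 (q \*: (@id R)) (q *: (1 : R)) by apply: is_deriveZ.
    have := @derive_val _ _ _ _ _ _ _ H; rewrite -[RHS]/(q * 1) mulr1; exact.
  rewrite -RintegralZl //; last first.
    apply: cont_integrable => u.
    by apply: (cvg_comp (fun u : R => q * u) p (cq u)); apply: cp.
  rewrite /Rintegral -[X in `[X, _]](mulr0 q).
  rewrite (@integration_by_substitution_increasing _ (fun x => q * x) p 0 t t0) ?dE.
  - by congr fine; apply: eq_integral => u _ /=; rewrite fctE /= mulrC.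
  - by move=> x y _ _ xy; rewrite ltr_pM2l.
  - by move=> x _; exact: cvg_cst.
  - exact: is_cvg_cst.
  - exact: is_cvg_cst.
  - split => //.
    + by apply: cvg_at_right_filter; apply: cq.
    + by apply: cvg_at_left_filter; apply: cq.
  - exact: continuous_subspaceT.
rewrite /cintegral RCmulE.
by rewrite (key (Re \o f)) ?(key (Im \o f)) //; [exact: Im_comp_cont|exact: Re_comp_cont].
Qed.

Lemma convol_within (f g : contC R) : {within `[0, +oo[, continuous
  (fun t => cintegral `[0, t] (fun u => f (t - u) * g u))}.
Proof.
pose f' t := f (Num.max 0 t); pose g' t := g (Num.max 0 t).
have cf : continuous f' by exact: contC_ext_continuous.
have cg : continuous g' by exact: contC_ext_continuous.
pose I (p q : R -> R) t := \int[mu]_(u in `[0, t]) (p (t - u) * q u).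
have cI (p q : R -> R) : continuous p -> continuous q ->
  {within `[0, +oo[, continuous (I p q)} by exact: Rconv_cont.
have rf := Re_comp_cont _ cf; have rg := Re_comp_cont _ cg.
have jf := Im_comp_cont _ cf; have jg := Im_comp_cont _ cg.
suff E t : t \in `[0, +oo[%classic ->
   (I (Re \o f') (Re \o g') t - I (Im \o f') (Im \o g') t)
   +i* (I (Re \o f') (Im \o g') t + I (Im \o f') (Re \o g') t) =
   cintegral `[0, t] (fun u => f (t - u) * g u).
  refine (subspace_eq_continuous E _).
  apply: continuous_complex => t.
    by apply: cvgB; [exact: (cI _ _ rf rg t)|exact: (cI _ _ jf jg t)].
  by apply: cvgD; [exact: (cI _ _ rf jg t)|exact: (cI _ _ jf rg t)].
move=> /set_mem /=; rewrite in_itv /= andbT => t0.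
have ci (p q : R -> R) : continuous p -> continuous q ->
    mu.-integrable `[0, t] (EFin \o (fun u => p (t - u) * q u)).
  move=> cp cq; apply: cont_integrable => u; apply: cvgM; last exact: cq.
  apply: (cvg_comp (fun u : R => t - u) p); last exact: cp.
  by apply: cvgB; [exact: cvg_cst|exact: cvg_id].
rewrite /I -RintegralB //; [|exact: ci ..].
rewrite -RintegralD //; [|exact: ci ..].
congr Complex; apply: eq_Rintegral => u /set_mem /=; rewrite in_itv /= => /andP[u0 ut];
  rewrite /f' /g' /= !(max_idPr _) ?subr_ge0 //;
  by case: (f _) => ? ?; case: (g _) => ? ?; simpc.
Qed.

Lemma convolE (f g : contC R) (t : R) : 0 <= t ->
  convol f g t = cintegral `[0, t] (fun u => f (t - u) * g u).
Proof. by move=> t0; rewrite CfunE //; exact: convol_within. Qed.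

Lemma mulNtE (a : contC R) (t : R) : 0 <= t -> mulNt a t = - t%:C * a t.
Proof.
move=> t0; rewrite CfunE // => x; apply: cvgM; last exact: contC_within.
apply: cvgN; move: x; apply: continuous_subspaceT; exact: RtoC_continuous.
Qed.

Lemma dilE (q : R) (a : contC R) (t : R) : 0 <= q -> 0 <= t -> dil q a t = q%:C * a (q * t).
Proof.
move=> q0 t0; rewrite CfunE //.
suff cG : {within `[0, +oo[, continuous (fun t => q%:C * a (Num.max 0 (q * t)))}.
  refine (subspace_eq_continuous _ cG) => x /set_mem /=; rewrite in_itv /= andbT => x0.
  by rewrite /from_subspace (max_idPr _) // mulr_ge0.
apply: continuous_subspaceT => x; apply: cvgM; first exact: cvg_cst.
apply: (cvg_comp (fun u : R => q * u) (fun t => a (Num.max 0 t))); last exact: contC_ext_continuous.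
by apply: cvgM; [exact: cvg_cst|exact: cvg_id].
Qed.

Lemma int_stepE (lambda t : R) : 0 <= t -> int_step lambda t =
  cintegral `[0, t] (fun u => if u <= lambda then 0 else 1).
Proof.
move=> t0; rewrite CfunE //.
pose H (u : R) : R := if u <= lambda then 0 else 1.
have mH : measurable_fun setT H.
  by apply: measurable_fun_if => //; apply: measurable_fun_ler.
have E t' : cintegral `[0, t'] (fun u => if u <= lambda then 0 else 1) =
   (\int[mu]_(u in `[0, t']) H u) +i* 0.
  rewrite /cintegral; congr Complex.
    by apply: eq_Rintegral => u _; rewrite /H; case: ifP.
  transitivity (\int[mu]_(u in `[0, t']) (0 : R)).
    by apply: eq_Rintegral => u _; case: ifP.
  by rewrite Rintegral_cst ?mul0r.
rewrite (_ : (fun t => _) = fun t => (\int[mu]_(u in `[0, t]) H u) +i* 0); last by apply/funext.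
apply: continuous_complex; last by move=> x; exact: cvg_cst.
apply: Rint_cont => T T0.
apply: (@le_integrable _ _ _ mu `[0, T] _ _ (EFin \o cst 1)) => //.
- by apply/measurable_EFinP; exact: measurable_funTS.
- by move=> u _; rewrite /= lee_fin /H; case: ifP => _; rewrite ?normr0 ?normr1.
- by apply: cont_integrable; exact: cst_continuous.
Qed.

Lemma mulNtD a b : mulNt (a + b) = mulNt a + mulNt b :> contC R.
Proof.
apply: contC_eq => t t0.
by rewrite -[RHS]/(mulNt a t + mulNt b t) !mulNtE // -mulrDr.
Qed.

Lemma mulNtM a b : mulNt (convol a b) = convol (mulNt a) b + convol a (mulNt b) :> contC R.
Proof.
apply: contC_eq => t t0.
rewrite -[RHS]/(convol (mulNt a) b t + convol a (mulNt b) t) mulNtE // !convolE //.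
pose a' t := a (Num.max 0 t); pose b' t := b (Num.max 0 t).
have ca : continuous (fun u => a' (t - u)).
  move=> u; apply: (cvg_comp (fun u : R => t - u) a'); last exact: contC_ext_continuous.
  by apply: cvgB; [exact: cvg_cst|exact: cvg_id].
have cb : continuous b' by exact: contC_ext_continuous.
have cab : continuous (fun u => a' (t - u) * b' u).
  by move=> u; apply: cvgM; [exact: ca|exact: cb].
rewrite -rmorphN.
rewrite (@eq_cintegral `[0, t] (fun u => a (t - u) * b u) (fun u => a' (t - u) * b' u)).
rewrite (@eq_cintegral `[0, t] (fun u => mulNt a (t - u) * b u) (fun u => (- (t - u))%:C * (a' (t - u) * b' u))).
rewrite (@eq_cintegral `[0, t] (fun u => a (t - u) * mulNt b u) (fun u => (- u)%:C * (a' (t - u) * b' u))).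
- rewrite -cintegralZ; last exact: cab.
  rewrite -cintegralD; first last.
  + move=> u; apply: cvgM; last exact: cab.
    apply: (cvg_comp (fun u : R => - u) (real_complex R)); last exact: RtoC_continuous.
    by apply: cvgN; exact: cvg_id.
  + move=> u; apply: cvgM; last exact: cab.
    apply: (cvg_comp (fun u : R => - (t - u)) (real_complex R)); last exact: RtoC_continuous.
    by apply: cvgN; apply: cvgB; [exact: cvg_cst|exact: cvg_id].
  by apply: eq_cintegral => u _; rewrite -mulrDl -raddfD; congr (_%:C * _); ring.
all: move=> u /set_mem /=; rewrite in_itv /= => /andP[u0 ut];
  rewrite /a' /b' ?mulNtE ?subr_ge0 // !(max_idPr _) ?subr_ge0 //.
  by rewrite rmorphN mulrCA.
by rewrite rmorphN mulrA.
Qed.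

Lemma dilD (q : R) a b : 0 <= q -> dil q (a + b) = dil q a + dil q b :> contC R.
Proof.
move=> q0; apply: contC_eq => t t0.
by rewrite -[RHS]/(dil q a t + dil q b t) !dilE // -mulrDr.
Qed.

Lemma dilM (q : R) a b : 0 < q -> dil q (convol a b) = convol (dil q a) (dil q b) :> contC R.
Proof.
move=> q0; apply: contC_eq => t t0.
have qt0 : 0 <= q * t by apply: mulr_ge0 => //; exact: ltW.
rewrite (dilE _ _ _ (ltW q0) t0) (convolE _ _ _ t0) (convolE _ _ _ qt0).
pose a' t := a (Num.max 0 t); pose b' t := b (Num.max 0 t).
have ca x : continuous (fun u => a' (x - u)).
  move=> u; apply: (cvg_comp (fun u : R => x - u) a'); last exact: contC_ext_continuous.
  by apply: cvgB; [exact: cvg_cst|exact: cvg_id].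
have cb : continuous b' by exact: contC_ext_continuous.
have cab x : continuous (fun u => a' (x - u) * b' u).
  by move=> u; apply: cvgM; [exact: ca|exact: cb].
rewrite (@eq_cintegral `[0, q * t] (fun u => a (q * t - u) * b u) (fun u => a' (q * t - u) * b' u)).
  rewrite cintegral_dil // -!cintegralZ; first last.
  - move=> u; apply: (cvg_comp (fun u : R => q * u) (fun u => a' (q * t - u) * b' u)); last exact: cab.
    by apply: cvgM; [exact: cvg_cst|exact: cvg_id].
  - move=> u; apply: cvgM; first exact: cvg_cst.
    apply: (cvg_comp (fun u : R => q * u) (fun u => a' (q * t - u) * b' u)); last exact: cab.
    by apply: cvgM; [exact: cvg_cst|exact: cvg_id].
  apply: eq_cintegral => u /set_mem /=; rewrite in_itv /= => /andP[u0 ut].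
  rewrite !dilE ?subr_ge0 ?(ltW q0) // /a' /b' -mulrBr !(max_idPr _) ?mulr_ge0 ?subr_ge0 ?(ltW q0) //.
  by ring.
move=> u /set_mem /=; rewrite in_itv /= => /andP[u0 ut].
by rewrite /a' /b' !(max_idPr _) ?subr_ge0.
Qed.

Lemma dil_eq0 (q : R) a : 0 < q -> dil q a = 0 :> contC R -> a = 0.
Proof.
move=> q0 a0; apply: contC_eq => t t0.
have qt : 0 <= q^-1 * t by rewrite mulr_ge0 ?invr_ge0 // ltW.
have := dilE q a (q^-1 * t) (ltW q0) qt.
rewrite a0 mulrA divff ?gt_eqF // mul1r -[LHS]/(0 : R[i]) => /esym/eqP.
by rewrite mulf_eq0 => /orP[/eqP/complexI/eqP|/eqP //]; rewrite gt_eqF.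
Qed.

End ContC.

Section Fractions.
Context {R : realType} {Q : fraction_field R}.

Lemma inC0 : inC 0 = 0 :> Q.
Proof. by apply: (addIr (inC 0)); rewrite -inCD !add0r. Qed.

Lemma inC_eq0 (a : contC R) : (inC a == 0 :> Q) = (a == 0).
Proof. by rewrite -inC0 (inj_eq (@inC_inj _ Q)). Qed.

Lemma dds_frac (a b : contC R) : b != 0 -> dds (inC a / inC b : Q) =
  (inC (mulNt a) * inC b - inC a * inC (mulNt b)) / inC b ^+ 2.
Proof.
move=> b0; rewrite /dds; case: xgetP => [y _ [c [d [d0 E ->]]] | none]; last first.
  by exfalso; apply: (none _); exists a, b; split.
have B0 : inC b != 0 :> Q by rewrite inC_eq0.
have D0 : inC d != 0 :> Q by rewrite inC_eq0.
have E1 : inC a * inC d = inC c * inC b :> Q.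
  by apply/eqP; rewrite -eqr_div //; apply/eqP.
have E2 : inC (mulNt a) * inC d + inC a * inC (mulNt d)
    = inC (mulNt c) * inC b + inC c * inC (mulNt b) :> Q.
  by rewrite -!inCM -!inCD -!mulNtM; congr (inC (mulNt _)); apply: (@inC_inj _ Q); rewrite !inCM.
have CE : inC c = inC a * inC d / inC b :> Q by rewrite E1 mulfK.
have CN : inC (mulNt c) = (inC (mulNt a) * inC d + inC a * inC (mulNt d) -
   inC c * inC (mulNt b)) / inC b :> Q by rewrite E2 addrK mulfK.
rewrite CN CE; field.
by rewrite B0 D0.
Qed.

Lemma tau_frac (q : R) (a b : contC R) : 0 < q -> b != 0 ->
  tau q (inC a / inC b : Q) = inC (dil q a) / inC (dil q b).
Proof.
move=> q0 b0; rewrite /tau; case: xgetP => [y _ [c [d [d0 E ->]]] | none]; last first.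
  by exfalso; apply: (none _); exists a, b; split.
have nz x : x != 0 -> inC (dil q x) != 0 :> Q.
  by rewrite inC_eq0; apply: contra_neq; exact: dil_eq0.
have E1 : inC a * inC d = inC c * inC b :> Q.
  by apply/eqP; rewrite -eqr_div ?inC_eq0 //; apply/eqP.
apply/eqP; rewrite eqr_div ?nz // -!inCM -!dilM //; apply/eqP.
by congr (inC (dil _ _)); apply: (@inC_inj _ Q); rewrite !inCM E1.
Qed.

End Fractions.

(* Main.v *)
Require Import Defs.
From HB Require Import structures.
From mathcomp Require Import all_boot all_order all_algebra.
From mathcomp Require Import complex.
From mathcomp Require Import all_classical all_reals all_analysis.
From mathcomp Require Import ring.

Import Order.TTheory GRing.Theory Num.Theory.
Import numFieldNormedType.Exports.

Local Open Scope classical_set_scope.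
Local Open Scope complex_scope.
Local Open Scope ring_scope.

(** The ramp [t |-> max 0 (t - n)] represents [h^n l^2], so that
    [l^2 \sum_n alpha_n h^n] is a sum of continuous functions of which only
    finitely many are nonzero on each bounded interval; this gives convergence.
    Limits in [Q(C)] are unique and are preserved by [tau_q], by [d/ds] and by
    multiplication by a nonzero constant, because convolution, [a |-> -t a] and
    dilation are continuous for locally uniform convergence. Hence both formulas
    reduce to finite sums, that is, to [tau_q h^lambda = h^(lambda/q)] and
    [(d/ds) h^lambda = - lambda h^lambda]. Convolution on [[0, t]] only sees the
    restrictions to [[0, t]], so the product of two series agrees there with a
    product of polynomials in [h]. *)

(** * Locally uniform convergence, convolution and delays on $[0,\infty)$ *)

Section ConvolutionRing.
Context {R : realType}.
Implicit Types (a b c f g : contC R) (t T e M : R).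
Local Notation mu := (@lebesgue_measure R).

(** The convergence clause of [Qcvg], isolated so that operators on [contC] can be shown continuous
    for it. *)
Definition ucvg (f_ : nat -> contC R) f := forall T : R,
  {uniform `[0, T], (fun n => f_ n : R -> R[i]) @ \oo --> (f : R -> R[i])}.

Lemma ucvgP (f_ : nat -> contC R) f : ucvg f_ f <->
  forall T e, 0 < e ->
    \forall n \near \oo, forall t, 0 <= t <= T -> `|f t - f_ n t| <= e%:C.
Proof.
split=> [cf T e e0|cf T].
  apply: (cf T [set h | forall t, 0 <= t <= T -> `|f t - h t| <= e%:C]).
  apply/uniform_nbhs; exists [set xy | ball xy.1 e%:C xy.2]; split.
    by rewrite -entourage_from_ballE; exists e%:C => //=; rewrite ltcR.
  move=> h /= fh t tT; apply: ltW; apply: fh.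
  by rewrite /= in_itv.
move=> P /uniform_nbhs[E [+ EP]].
rewrite -entourage_from_ballE => -[d /= d0 dE].
have dR : (complex.Re d)%:C = d by apply: RRe_real; apply: gtr0_real.
have Rd0 : 0 < complex.Re d by rewrite -ltcR dR.
(* Half the radius turns the non-strict bound of [cf] into the strict one that [ball] asks for. *)
have := cf T (complex.Re d / 2) (divr_gt0 Rd0 (ltr0Sn _ 1)).
apply: filterS => n fn; apply: EP => t /= tT; apply: dE => /=.
apply: le_lt_trans (fn t _) _; first by move: tT; rewrite in_itv.
by rewrite -dR ltcR ltr_pdivrMr // ltr_pMr // ltr1n.
Qed.

Lemma normC_le_ReIm (z : R[i]) : `|z| <= (`|complex.Re z| + `|complex.Im z|)%:C.
Proof.
case: z => x y; rewrite normc_def lecR /= -(@ler_pXn2r _ 2) ?nnegrE ?sqrtr_ge0 //.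
  rewrite sqr_sqrtr ?addr_ge0 ?sqr_ge0 // sqrrD !real_normK ?num_real //.
  by rewrite addrAC lerDl mulrn_wge0 // mulr_ge0.
Qed.

Lemma contC_bounded a T :
  exists M, 0 <= M /\ forall t, 0 <= t <= T -> `|a t| <= M%:C.
Proof.
have ca := contC_ext_continuous a.
have [M1 H1] := cont_bounded _ 0 T (Re_comp_cont _ ca).
have [M2 H2] := cont_bounded _ 0 T (Im_comp_cont _ ca).
exists (`|M1| + `|M2|); split; first by rewrite addr_ge0.
move=> t tT; apply: le_trans (normC_le_ReIm _) _; rewrite lecR.
have t0 : Num.max 0 t = t by apply/max_idPr; case/andP: tT.
apply: lerD; (apply: le_trans; last exact: ler_norm).
  by have := H1 t; rewrite /= t0; apply; rewrite in_itv.
by have := H2 t; rewrite /= t0; apply; rewrite in_itv.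
Qed.

(** The integrand of the convolution with both arguments clamped at 0: it is continuous in [u] on
    the whole line, hence integrable on segments, and is unchanged for $0\le u\le t$. *)
Definition kern a b t u := a (Num.max 0 (t - u)) * b (Num.max 0 u).

Lemma kern_continuous a b t : continuous (kern a b t).
Proof.
move=> u; apply: cvgM; last exact: contC_ext_continuous.
apply: (cvg_comp (fun u : R => t - u) (fun x => a (Num.max 0 x))).
  by apply: cvgB; [exact: cvg_cst|exact: cvg_id].
exact: contC_ext_continuous.
Qed.

Lemma kernE a b t u : 0 <= u <= t -> kern a b t u = a (t - u) * b u.
Proof. by move=> /andP[u0 ut]; rewrite /kern !(max_idPr _) ?subr_ge0. Qed.

Lemma convol_kern a b t : 0 <= t ->
  convol a b t = cintegral `[0, t] (kern a b t).
Proof.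
move=> t0; rewrite convolE //; apply: eq_cintegral => u /set_mem /=.
by rewrite in_itv => /kernE ->.
Qed.

(** Causality: for $u$ in $[0,t]$, both $u$ and $t-u$ stay in $[0,t]$. It allows series to be
    truncated inside a convolution. *)
Lemma eq_convol a a' b b' t : (forall u, 0 <= u <= t -> a u = a' u) ->
  (forall u, 0 <= u <= t -> b u = b' u) -> 0 <= t ->
  convol a b t = convol a' b' t.
Proof.
move=> aE bE t0; rewrite !convolE //; apply: eq_cintegral => u /set_mem /=.
rewrite in_itv /= => /andP[u0 ut]; rewrite aE ?bE ?u0 //.
by rewrite subr_ge0 ut lerBlDr lerDl.
Qed.

Lemma convolDr a : {morph convol a : b c / b + c}.
Proof.
move=> b c; apply: contC_eq => t t0.
rewrite -[RHS]/(convol a b t + convol a c t) !convol_kern //.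
rewrite -cintegralD; [|exact: kern_continuous ..].
by apply: eq_cintegral => u _; rewrite /kern -mulrDr.
Qed.

Lemma convolBr a : {morph convol a : b c / b - c}.
Proof.
move=> b c; apply: (addIr (convol a c)).
by rewrite -convolDr !subrK.
Qed.

Lemma fine_lebesgue_itv0 t : 0 <= t -> fine (mu `[0, t]%classic) = t.
Proof.
rewrite lebesgue_measure_itv /= lte_fin le_eqVlt.
by case: ltgtP => //= _ _; rewrite subr0.
Qed.

Lemma convolNr a b : convol a (- b) = - convol a b.
Proof.
have a0 : convol a 0 = 0 by rewrite -[in LHS](subrr b) convolBr subrr.
by rewrite -[- b]sub0r convolBr a0 sub0r.
Qed.

Lemma cintegral_cst t (z : R[i]) : 0 <= t ->
  cintegral `[0, t] (fun=> z) = t%:C * z.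
Proof.
move=> t0; case: z => x y; rewrite /cintegral /= !Rintegral_cst //.
by rewrite fine_lebesgue_itv0 //; simpc; rewrite ![t * _]mulrC.
Qed.

Lemma Rint_norm_le (p : R -> R) t M : continuous p -> 0 <= t ->
  (forall u, 0 <= u <= t -> `|p u| <= M) ->
  `|\int[mu]_(u in `[0, t]) p u| <= t * M.
Proof.
move=> cp t0 pM; apply: le_trans (le_normr_Rintegral _ _) _ => //.
  exact: cont_integrable.
apply: le_trans (_ : \int[mu]_(u in `[0, t]) M <= _).
  apply: le_Rintegral => //.
  - by apply: cont_integrable => u; apply: cvg_norm; exact: cp.
  - by apply: cont_integrable => u; exact: cvg_cst.
by rewrite Rintegral_cst // mulrC fine_lebesgue_itv0.
Qed.

(** Real and imaginary parts are bounded separately, whence twice the sharp constant. *)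
Lemma cintegral_norm_le (p : R -> R[i]) t M : continuous p -> 0 <= t ->
  (forall u, 0 <= u <= t -> `|p u| <= M%:C) ->
  `|cintegral `[0, t] p| <= (t * M + t * M)%:C.
Proof.
move=> cp t0 pM; apply: le_trans (normC_le_ReIm _) _; rewrite lecR.
apply: lerD; apply: Rint_norm_le => //.
- exact: Re_comp_cont.
- by move=> u /pM; rewrite -lecR; apply: le_trans; exact: normc_ge_Re.
- exact: Im_comp_cont.
- by move=> u /pM; rewrite -lecR; apply: le_trans; exact: normc_ge_Im.
Qed.

Lemma ucvg_convol a (f_ : nat -> contC R) f :
  ucvg f_ f -> ucvg (fun n => convol a (f_ n)) (convol a f).
Proof.
move=> /ucvgP cf; apply/ucvgP => T e e0.
have [M [M0 aM]] := contC_bounded a T.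
have [T0|T0] := ltP T 0.
  apply: nearW => n t /andP[t0 tT].
  by have := le_lt_trans (le_trans t0 tT) T0; rewrite ltxx.
(* $2TM$ bounds convolution by [a] on $[0,T]$; the summand 1 keeps the divisor positive when
   $TM=0$. *)
have k0 : 0 < T * M + T * M + 1 by rewrite ltr_wpDl // addr_ge0 // mulr_ge0.
have := cf T (e / (T * M + T * M + 1)) (divr_gt0 e0 k0).
apply: filterS => n fn t /andP[t0 tT].
rewrite -[_ - _]/((convol a f - convol a (f_ n)) t) -convolBr convol_kern //.
pose e' := e / (T * M + T * M + 1).
have e'0 : 0 <= e' by rewrite divr_ge0 // ltW.
apply: le_trans (_ : (t * (M * e') + t * (M * e'))%:C <= _).
  apply: cintegral_norm_le => //; first exact: kern_continuous.
  move=> u ut; case/andP: (ut) => u0 u1.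
  rewrite kernE // normrM rmorphM ler_pM //.
    by apply: aM; rewrite subr_ge0 u1 (le_trans _ tT) // lerBlDr lerDl.
  by apply: fn; rewrite u0 (le_trans u1).
rewrite lecR.
apply: le_trans (_ : (T * M + T * M + 1) * e' <= _); last first.
  by rewrite /e' mulrCA divff ?mulr1 // gt_eqF.
rewrite mulrA -mulrDl ler_wpM2r // ler_wpDr //.
by apply: lerD; rewrite ler_wpM2r.
Qed.

Lemma ucvg_unique (f_ : nat -> contC R) f g : ucvg f_ f -> ucvg f_ g -> f = g.
Proof.
move=> /ucvgP cf /ucvgP cg; apply: contC_eq => t t0.
apply/eqP; rewrite -subr_eq0 -normr_le0.
suff H e : 0 < e -> `|f t - g t| <= (e + e)%:C.
  have : complex.Re `|f t - g t| <= 0.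
    apply/ler_addgt0Pl => e e0; rewrite addr0 -lecR RRe_real ?normr_real //.
    by have /H := divr_gt0 e0 (ltr0Sn R 1); rewrite -splitr.
  by rewrite -lecR RRe_real ?normr_real.
move=> e0.
have [n [fn gn]] := filter_ex (filterI (cf t e e0) (cg t e e0)).
apply: le_trans (ler_distD (f_ n t) _ _) _; rewrite rmorphD.
apply: lerD; first by apply: fn; rewrite t0 lexx.
by rewrite distrC; apply: gn; rewrite t0 lexx.
Qed.

Lemma ucvgD (f_ g_ : nat -> contC R) f g :
  ucvg f_ f -> ucvg g_ g -> ucvg (fun n => f_ n + g_ n) (f + g).
Proof.
move=> /ucvgP cf /ucvgP cg; apply/ucvgP => T e e0.
have e20 : 0 < e / 2 by exact: divr_gt0.
apply: filterS2 (cf T _ e20) (cg T _ e20) => n fn gn t tT.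
rewrite -[_ - _]/(f t + g t - (f_ n t + g_ n t)) opprD addrACA.
rewrite (splitr e) rmorphD.
by apply: le_trans (ler_normD _ _) _; apply: lerD; [exact: fn|exact: gn].
Qed.

Lemma ucvg_mulNt (f_ : nat -> contC R) f :
  ucvg f_ f -> ucvg (fun n => mulNt (f_ n)) (mulNt f).
Proof.
move=> /ucvgP cf; apply/ucvgP => T e e0.
(* A positive bound for the multiplier $t$ on $[0,T]$, whatever the sign of [T]. *)
have T1 : 0 < `|T| + 1 by rewrite ltr_wpDl.
have := cf T _ (divr_gt0 e0 T1).
apply: filterS => n fn t /[dup] tT /andP[t0 tT'].
rewrite !mulNtE // -mulrBr normrM normrN.
have -> : `|t%:C| = t%:C by rewrite ger0_norm // lecR.
apply: le_trans (_ : (`|T| + 1)%:C * (e / (`|T| + 1))%:C <= _); last first.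
  by rewrite -rmorphM mulrCA divff ?mulr1 // gt_eqF.
apply: ler_pM => //; [by rewrite lecR| |exact: fn].
by rewrite lecR (le_trans tT') // (le_trans (ler_norm _)) // lerDl.
Qed.

Lemma ucvg_dil (q : R) (f_ : nat -> contC R) f : 0 < q ->
  ucvg f_ f -> ucvg (fun n => dil q (f_ n)) (dil q f).
Proof.
move=> q0 /ucvgP cf; apply/ucvgP => T e e0.
(* The values at $qt$ are used, so closeness is required on $[0,qT]$; [e / q] absorbs the factor $q$
   of [dil]. *)
have := cf (q * T) _ (divr_gt0 e0 q0).
apply: filterS => n fn t /andP[t0 tT].
have q0' := ltW q0.
rewrite !dilE // -mulrBr normrM.
have -> : `|q%:C| = q%:C by rewrite ger0_norm // lecR.
apply: le_trans (_ : q%:C * (e / q)%:C <= _); last first.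
  by rewrite -rmorphM mulrCA divff ?mulr1 // gt_eqF.
apply: ler_wpM2l; first by rewrite lecR.
by apply: fn; rewrite mulr_ge0 //= ler_wpM2l.
Qed.

Lemma ucvg_reindex (phi : nat -> nat) (f_ : nat -> contC R) f :
  phi n @[n --> \oo] --> \oo -> ucvg f_ f -> ucvg (f_ \o phi) f.
Proof. by move=> cphi cf T; apply: cvg_comp cphi (cf T). Qed.

Lemma ucvg_near (f_ : nat -> contC R) f : (forall T : R,
    \forall n \near \oo, forall t, 0 <= t <= T -> f_ n t = f t) -> ucvg f_ f.
Proof.
move=> cf; apply/ucvgP => T e e0; apply: filterS (cf T) => n fn t tT.
by rewrite fn // subrr normr0 lecR ltW.
Qed.

(* Elements of contC vanish on ]-oo, 0[, so this is the right translate of f,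
   provided that f 0 = 0; otherwise it is the junk value 0 in general. *)
Definition delay (lambda : R) f : contC R := Cfun (fun t => f (t - lambda)).

Lemma contC_lt0 f t : t < 0 -> f t = 0.
Proof. by case/asboolP: (contC_funP f) => _; apply. Qed.

Lemma delayE (lambda : R) f t : f 0 = 0 -> 0 <= t ->
  delay lambda f t = f (t - lambda).
Proof.
move=> f0 t0; rewrite CfunE //; apply: continuous_subspaceT => x.
rewrite (_ : (fun t => f (t - lambda)) = (fun t => f (Num.max 0 (t - lambda)))).
  apply: (cvg_comp (fun u : R => u - lambda) (fun x => f (Num.max 0 x))).
    by apply: cvgB; [exact: cvg_id|exact: cvg_cst].
  exact: contC_ext_continuous.
apply/funext => u; case: (leP 0 (u - lambda)) => // ul.
by rewrite f0 contC_lt0.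
Qed.

Lemma cintegral_eq0 (A : set R) (p : R -> R[i]) : measurable A ->
  {in A, p =1 fun=> 0} -> cintegral A p = 0.
Proof.
move=> mA p0; rewrite (eq_cintegral _ _ _ p0).
by rewrite /cintegral /= !Rintegral_cst // !mul0r.
Qed.

Lemma convol0 a b : convol a b 0 = 0.
Proof. by rewrite convol_kern // set_itv1 /cintegral !Rintegral_set1. Qed.

Lemma cintegral_split (p : R -> R[i]) s t : continuous p -> 0 <= s <= t ->
  (forall u, s < u <= t -> p u = 0) ->
  cintegral `[0, t] p = cintegral `[0, s] p.
Proof.
move=> cp /andP[s0 st] p0.
have UE : `[0, t]%classic = `[0, s]%classic `|` `]s, t]%classic :> set R.
  by rewrite -itv_bndbnd_setU ?bnd_simp.
have dis : [disjoint `[0, s]%classic & `]s, t]%classic].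
  apply/disj_setPS => u /= []; rewrite !in_itv /= => /andP[_ us] /andP[su _].
  by have := lt_le_trans su us; rewrite ltxx.
rewrite /cintegral {1 2}UE !Rintegral_setU //=; last 2 first.
- by rewrite -UE; apply: cont_integrable; exact: Im_comp_cont.
- by rewrite -UE; apply: cont_integrable; exact: Re_comp_cont.
have : cintegral `]s, t] p = 0.
  by apply: cintegral_eq0 => // u /set_mem /=; rewrite in_itv => /p0.
by move=> [-> ->]; rewrite !addr0.
Qed.

(** If $t<\lambda$, the delayed factor vanishes throughout $[0,t]$. Otherwise the integrand vanishes
    for $u>t-\lambda$, and what is left is the convolution at $t-\lambda$. *)
Lemma convol_delay (lambda : R) f g : 0 <= lambda -> f 0 = 0 ->
  convol (delay lambda f) g = delay lambda (convol f g).
Proof.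
move=> l0 f0; apply: contC_eq => t t0.
rewrite delayE ?convol0 // convol_kern //.
have [tl|tl] := ltP t lambda.
  rewrite contC_lt0 ?subr_lt0 //; apply: cintegral_eq0 => // u /set_mem /=.
  rewrite in_itv /= => /[dup] /andP[u0 ut] /kernE ->.
  by rewrite delayE ?subr_ge0 // contC_lt0 ?mul0r // subr_lt0 ltrBlDr ltr_wpDr.
have stl : 0 <= t - lambda <= t by rewrite subr_ge0 tl lerBlDr lerDl.
rewrite (@cintegral_split _ (t - lambda)) //; first last.
- move=> u /andP[ul ut].
  have u0 : 0 <= u by rewrite (le_trans _ (ltW ul)) // subr_ge0.
  rewrite kernE ?u0 // delayE ?subr_ge0 // contC_lt0 ?mul0r //.
  by rewrite subr_lt0 ltrBlDr -ltrBlDl.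
- exact: kern_continuous.
rewrite convol_kern ?subr_ge0 //; apply: eq_cintegral => u /set_mem /=.
rewrite in_itv /= => /[dup] uti /andP[u0 ut].
have ut' : u <= t by rewrite (le_trans ut) // lerBlDr lerDl.
by rewrite !kernE ?u0 // delayE ?subr_ge0 // addrAC.
Qed.

End ConvolutionRing.

(** * Constants, scalar multiples and ramps *)

Section Steps.
Context {R : realType}.
Implicit Types (f : contC R) (t : R) (z w : R[i]).
Local Notation mu := (@lebesgue_measure R).

Definition contC_cst z : contC R := Cfun (fun=> z).

Lemma contC_cstE z t : 0 <= t -> contC_cst z t = z.
Proof. by move=> t0; rewrite CfunE // => x; exact: cvg_cst. Qed.

Definition contC_scale z f : contC R := Cfun (fun t => z * f t).

Lemma contC_scaleE z f t : contC_scale z f t = z * f t.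
Proof.
have [t0|t0] := leP 0 t; last by rewrite !contC_lt0 ?mulr0.
rewrite CfunE // => x; apply: cvgM; first exact: cvg_cst.
exact: contC_within.
Qed.

Lemma fine_lebesgue_itvoc (s t : R) : fine (mu `]s, t]%classic) = Num.max 0 (t - s).
Proof.
rewrite lebesgue_measure_itv /= lte_fin.
case: ltP => st; first by rewrite /= max_r // subr_ge0 ltW.
by rewrite /= max_l // subr_le0.
Qed.

Lemma int_step_max (lambda t : R) : 0 <= lambda -> 0 <= t ->
  int_step lambda t = (Num.max 0 (t - lambda))%:C.
Proof.
move=> l0 t0; rewrite int_stepE // /cintegral; congr Complex; last first.
  rewrite -[RHS](mul0r (fine (mu `[0, t]%classic))).
  rewrite -Rintegral_cst //.
  by apply: eq_Rintegral => u _; case: ifP.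
(* The step is the indicator function of
   $]\lambda,\infty[$, so the integral is the length of $]\lambda,t]$. *)
transitivity (\int[mu]_(u in `[0, t])
    ((fun=> 1 : R) \_ `]lambda, +oo[) u).
  apply: eq_Rintegral => u _; rewrite patchE.
  by case: ifP => ul; [rewrite memNset|rewrite mem_set] => //=;
    rewrite in_itv /= andbT ltNge ul.
rewrite -Rintegral_mkcondr.
have -> : `[0, t] `&` `]lambda, +oo[ = `]lambda, t]%classic :> set R.
  apply/seteqP; split=> u /=; rewrite !in_itv /= andbT.
    by move=> [/andP[_ ->] ->].
  by move=> /andP[lu ->]; rewrite lu (le_trans l0 (ltW lu)).
by rewrite Rintegral_cst // mul1r; exact: fine_lebesgue_itvoc.
Qed.

Lemma int_step00 : int_step (0 : R) 0 = 0.
Proof. by rewrite int_step_max // subrr maxxx. Qed.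

(** Reduces computations with $h^\lambda$ to delays of the single function $\{t\}$. *)
Lemma int_step_delay (lambda : R) : 0 <= lambda ->
  int_step lambda = delay lambda (int_step 0).
Proof.
move=> l0; apply: contC_eq => t t0; rewrite delayE ?int_step00 //.
rewrite int_step_max //; have [tl|tl] := leP 0 (t - lambda).
  by rewrite int_step_max // subr0 max_r.
by rewrite contC_lt0.
Qed.

Lemma delay_delay (lambda mu : R) f : 0 <= lambda -> 0 <= mu -> f 0 = 0 ->
  delay lambda (delay mu f) = delay (lambda + mu) f.
Proof.
move=> l0 m0 f0; apply: contC_eq => t t0.
have f'0 x : x <= 0 -> f x = 0.
  by rewrite le_eqVlt => /orP[/eqP->//|/contC_lt0 ->].
rewrite delayE //; last first.
  by rewrite delayE // f'0 // sub0r oppr_le0.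
rewrite [RHS]delayE // opprD addrA.
have [tl|tl] := ltP (t - lambda) 0.
  by rewrite contC_lt0 // f'0 // subr_le0 (le_trans (ltW tl)).
by rewrite delayE.
Qed.

Lemma convol_cst1 : convol (contC_cst 1) (contC_cst 1) = int_step 0.
Proof.
apply: contC_eq => t t0; rewrite int_step_max // subr0 max_r //.
rewrite convolE // -[RHS]mulr1 -cintegral_cst //.
apply: eq_cintegral => u /set_mem /=; rewrite in_itv /= => /andP[u0 ut].
by rewrite !contC_cstE ?subr_ge0 // mulr1.
Qed.

(** The scalar passes under the integral from one factor to the other; through this [scalar_op z]
    acts on [contC] as pointwise multiplication by [z]. *)
Lemma convol_cst z f : convol (contC_cst z) f = convol (contC_cst 1) (contC_scale z f).
Proof.
apply: contC_eq => t t0; rewrite (convolE (contC_cst z)) // (convolE (contC_cst 1)) //.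
apply: eq_cintegral => u /set_mem /=; rewrite in_itv /= => /andP[u0 ut].
by rewrite contC_scaleE !contC_cstE ?subr_ge0 // mul1r.
Qed.

(** Write $-t=-(t-\lambda)-\lambda$; the last term is the source of the factor $-\lambda$ in
    $\frac{d}{ds}h^\lambda$. *)
Lemma mulNt_delay (lambda : R) f : 0 <= lambda -> f 0 = 0 ->
  mulNt (delay lambda f) =
  delay lambda (mulNt f) - contC_scale lambda%:C (delay lambda f).
Proof.
move=> l0 f0; apply: contC_eq => t t0.
rewrite -[RHS]/(delay lambda (mulNt f) t - contC_scale lambda%:C (delay lambda f) t).
have nf0 : mulNt f 0 = 0 by rewrite mulNtE // f0 mulr0.
rewrite mulNtE // (contC_scaleE _ (delay lambda f)) (delayE lambda f) //.
rewrite (delayE lambda (mulNt f)) //.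
have [tl|tl] := ltP (t - lambda) 0; first by rewrite !contC_lt0 // !mulr0 subr0.
by rewrite mulNtE // rmorphB; ring.
Qed.

Lemma mulNt_cst1 : mulNt (contC_cst 1) = - int_step 0.
Proof.
apply: contC_eq => t t0; rewrite -[RHS]/(- int_step 0 t).
by rewrite int_step_max // subr0 max_r // mulNtE // contC_cstE // mulr1.
Qed.

Lemma dil_cst (q : R) z : 0 < q -> dil q (contC_cst z) = contC_scale q%:C (contC_cst z).
Proof.
move=> q0; apply: contC_eq => t t0; rewrite dilE ?(ltW q0) // contC_scaleE.
by rewrite !contC_cstE // mulr_ge0 // ltW.
Qed.

(** $\max(0,qt-\lambda)=q\max(0,t-\lambda/q)$ gives one factor $q$; the other comes from [dil]
    itself. *)
Lemma dil_int_step (q lambda : R) : 0 < q -> 0 <= lambda ->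
  dil q (int_step lambda) = contC_scale (q ^+ 2)%:C (int_step (lambda / q)).
Proof.
move=> q0 l0; have q0' := ltW q0; apply: contC_eq => t t0.
rewrite dilE // contC_scaleE !int_step_max ?mulr_ge0 ?invr_ge0 //.
rewrite -!rmorphM expr2 -mulrA; congr (_ * _)%:C.
by rewrite maxr_pMr // mulr0 mulrBr [q * (_ / _)]mulrC divfK ?gt_eqF.
Qed.

Lemma contC_cstD z w : contC_cst (z + w) = contC_cst z + contC_cst w.
Proof.
by apply: contC_eq => t t0; rewrite -[RHS]/(contC_cst z t + contC_cst w t) !contC_cstE.
Qed.

Lemma contC_cstM z w : contC_cst (z * w) = contC_scale z (contC_cst w).
Proof. by apply: contC_eq => t t0; rewrite contC_scaleE !contC_cstE. Qed.

Lemma contC_cst1_neq0 : contC_cst 1 != 0.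
Proof.
apply/eqP => /(congr1 (fun f : contC R => f 0)); rewrite contC_cstE //.
by move/eqP; rewrite -[X in _ == X]/(0 : R[i]) oner_eq0.
Qed.

End Steps.

(** * Extending a derivation to fractions by the quotient rule *)

Section QuotientRule.
Variables (K : fieldType) (A : zmodType) (i : A -> K).
Variables (m : A -> A -> A) (delta : A -> A) (D : K -> K).
Hypotheses (iD : {morph i : a b / a + b}) (iM : {morph i : a b / m a b >-> a * b}).
Hypothesis i_eq0 : forall a, (i a == 0) = (a == 0).
Hypothesis deltaD : {morph delta : a b / a + b}.
Hypothesis deltaM : forall a b, delta (m a b) = m (delta a) b + m a (delta b).
Hypothesis D_frac : forall a b, b != 0 ->
  D (i a / i b) = (i (delta a) * i b - i a * i (delta b)) / i b ^+ 2.
Hypothesis i_frac : forall x, exists a b, b != 0 /\ x = i a / i b.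

(** [D_frac] applies to every representative, so the sum is put over the common denominator [m b d]
    and [deltaM] expands both parts; an identity of rational functions remains. *)
Lemma quotient_ruleD : {morph D : x y / x + y}.
Proof using iD iM i_eq0 deltaD deltaM D_frac i_frac.
move=> x y; have [a [b [b0 ->]]] := i_frac x; have [c [d [d0 ->]]] := i_frac y.
have bd0 : m b d != 0 by rewrite -i_eq0 iM mulf_neq0 // i_eq0.
rewrite addf_div ?i_eq0 // -!iM -iD !D_frac // deltaD !deltaM !iD !iM.
by field; rewrite !i_eq0 b0 d0.
Qed.

Lemma quotient_ruleM x y : D (x * y) = D x * y + x * D y.
Proof using iD iM i_eq0 deltaM D_frac i_frac.
have [a [b [b0 ->]]] := i_frac x; have [c [d [d0 ->]]] := i_frac y.
have bd0 : m b d != 0 by rewrite -i_eq0 iM mulf_neq0 // i_eq0.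
rewrite mulf_div -!iM !D_frac // !deltaM !iD !iM.
by field; rewrite !i_eq0 b0 d0.
Qed.

End QuotientRule.

(** * Scalars and translation operators in $Q(\mathcal{C})$ *)

Section FractionField.
Context {R : realType} {Q : fraction_field R}.
Implicit Types (f : contC R) (x y p : Q) (u : nat -> Q).

Lemma inCB : {morph (inC : contC R -> Q) : a b / a - b}.
Proof. by move=> a b; apply: (addIr (inC b)); rewrite -inCD !subrK. Qed.

Local Notation l := (l_op : Q).

Lemma l_neq0 : l != 0.
Proof. by rewrite inC_eq0 contC_cst1_neq0. Qed.

Lemma l_sqr : inC (int_step 0) = l ^+ 2.
Proof. by rewrite -convol_cst1 inCM expr2. Qed.

Lemma int_step0_neq0 : int_step 0 != 0 :> contC R.
Proof. by rewrite -(@inC_eq0 _ Q) l_sqr expf_neq0 // l_neq0. Qed.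

(** The two divisions by [l_op] combine into one by $l^2=\{t\}$, which is [int_step 0]. *)
Lemma translE (lambda : R) :
  transl lambda = inC (int_step lambda) / inC (int_step 0) :> Q.
Proof.
rewrite /transl /s_op l_sqr; field; exact: l_neq0.
Qed.

Lemma scalar_inC z f : scalar_op z * inC f = inC (contC_scale z f) :> Q.
Proof.
apply: (mulfI l_neq0); rewrite -[in RHS]inCM -convol_cst inCM.
by rewrite /scalar_op -/l mulrA mulrCA divff ?l_neq0 // mulr1.
Qed.

Lemma scalar_is_zmod_morphism : zmod_morphism (scalar_op : R[i] -> Q).
Proof.
move=> z w; rewrite /scalar_op -mulrBl -inCB; congr (inC _ / _).
by apply: (addIr (contC_cst w)); rewrite -contC_cstD !subrK.
Qed.

Lemma scalar_is_monoid_morphism : monoid_morphism (scalar_op : R[i] -> Q).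
Proof.
split=> [|z w]; first by rewrite /scalar_op divff // l_neq0.
apply: (mulIf l_neq0); rewrite -[l]/(inC (contC_cst 1)) -[RHS]mulrA.
by rewrite !scalar_inC -!contC_cstM !mulr1.
Qed.

HB.instance Definition _ := GRing.isZmodMorphism.Build _ _
  (scalar_op : R[i] -> Q) scalar_is_zmod_morphism.
HB.instance Definition _ := GRing.isMonoidMorphism.Build _ _
  (scalar_op : R[i] -> Q) scalar_is_monoid_morphism.

Lemma scalar_eq0 z : ((scalar_op z : Q) == 0) = (z == 0).
Proof. exact: fmorph_eq0. Qed.

(** Inherited from the field [Q] through the injectivity of [inC]. *)
Lemma convolC : commutative (convol : contC R -> contC R -> contC R).
Proof. by move=> a b; apply: (@inC_inj _ Q); rewrite !inCM mulrC. Qed.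

(** This is $h^\lambda h^\mu=h^{\lambda+\mu}$ multiplied by $l^4$: both delays are pulled out of the
    convolution and then added. *)
Lemma convol_int_step (lambda mu : R) : 0 <= lambda -> 0 <= mu ->
  convol (int_step lambda) (int_step mu) =
  convol (int_step (lambda + mu)) (int_step 0).
Proof.
move=> l0 m0; have i00 := @int_step00 R.
have lm0 := addr_ge0 l0 m0.
rewrite (int_step_delay lambda l0) (int_step_delay _ lm0).
rewrite (convol_delay _ _ _ l0 i00) (convol_delay _ _ _ lm0 i00).
rewrite convolC (int_step_delay _ m0) (convol_delay _ _ _ m0 i00).
exact: delay_delay (convol0 _ _).
Qed.

Lemma translD (lambda mu : R) : 0 <= lambda -> 0 <= mu ->
  transl lambda * transl mu = transl (lambda + mu) :> Q.
Proof.
move=> l0 m0; rewrite !translE mulf_div -inCM.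
rewrite convol_int_step // inCM.
by rewrite -mulf_div divff ?mulr1 // inC_eq0 int_step0_neq0.
Qed.

Lemma transl0 : transl 0 = 1 :> Q.
Proof. by rewrite translE divff // inC_eq0 int_step0_neq0. Qed.

Lemma translX (lambda : R) n : 0 <= lambda ->
  transl lambda ^+ n = transl (lambda *+ n) :> Q.
Proof.
move=> l0; elim: n => [|n IH]; first by rewrite expr0 transl0.
by rewrite exprS IH translD -?mulrS // mulrn_wge0.
Qed.

Lemma transl_neq0 (lambda : R) : 0 <= lambda -> transl lambda != 0 :> Q.
Proof.
move=> l0; rewrite translE mulf_neq0 ?invr_eq0 ?inC_eq0 ?int_step0_neq0 //.
(* At [lambda + 1] the ramp takes the value 1. *)
apply/eqP => /(congr1 (fun f : contC R => f (lambda + 1))).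
rewrite int_step_max ?addr_ge0 // addrAC subrr add0r max_r //.
by move/eqP; rewrite -[X in _ == X]/(0 : R[i]) oner_eq0.
Qed.

Lemma convol_neq0 (a b : contC R) : a != 0 -> b != 0 -> convol a b != 0.
Proof.
by move=> a0 b0; rewrite -(@inC_eq0 _ Q) inCM mulf_neq0 // inC_eq0.
Qed.

(** * The operator $\tau_q$ on $Q(\mathcal{C})$ for $q>0$ *)

Section Tau.
Variables (q : R) (q0 : 0 < q).

Lemma dil_neq0 (a : contC R) : a != 0 -> dil q a != 0.
Proof. by apply: contra_neq; exact: dil_eq0. Qed.

Lemma tau_inC f : tau q (inC f) = inC (dil q f) :> Q.
Proof.
have c0 := @contC_cst1_neq0 R.
(* [tau_frac] needs a fraction, and [contC] has no unit to serve as denominator; any nonzero element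
   would do, here $\{1\}$. *)
have -> : inC f = inC (convol f (contC_cst 1)) / inC (contC_cst 1) :> Q.
  by rewrite inCM mulfK // inC_eq0.
by rewrite tau_frac // dilM // inCM mulfK // inC_eq0 dil_neq0.
Qed.

Lemma tauM : {morph (tau q : Q -> Q) : x y / x * y}.
Proof.
move=> x y; have [a [b [b0 ->]]] := inC_frac x.
have [c [d [d0 ->]]] := inC_frac y.
rewrite mulf_div -!inCM !tau_frac ?convol_neq0 // !dilM //.
by move: (dil q a) (dil q b) (dil q c) (dil q d) => *; rewrite !inCM mulf_div.
Qed.

Lemma tauD : {morph (tau q : Q -> Q) : x y / x + y}.
Proof.
move=> x y; have [a [b [b0 ->]]] := inC_frac x.
have [c [d [d0 ->]]] := inC_frac y.
rewrite addf_div ?inC_eq0 // -!inCM -inCD !tau_frac ?convol_neq0 //.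
rewrite dilD ?(ltW q0) // !dilM //.
have := dil_neq0 _ b0; have := dil_neq0 _ d0.
move: (dil q a) (dil q b) (dil q c) (dil q d) => a' b' c' d' d'0 b'0.
by rewrite inCD !inCM addf_div ?inC_eq0.
Qed.

Lemma tau1 : tau q 1 = 1 :> Q.
Proof.
have /dil_neq0 := @contC_cst1_neq0 R; rewrite -(@inC_eq0 _ Q) -tau_inC => c0.
by apply: (mulfI c0); rewrite -tauM !mulr1.
Qed.

Lemma tau0 : tau q 0 = 0 :> Q.
Proof. by apply: (addIr (tau q 0)); rewrite -tauD !add0r. Qed.

Lemma tau_eq0 x : (tau q x == 0) = (x == 0).
Proof.
have [->|x0] := eqVneq x 0; first by rewrite tau0 eqxx.
apply/eqP => tx0; have := oner_eq0 Q; rewrite -tau1 -(divff x0) tauM tx0.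
by rewrite mul0r eqxx.
Qed.

Lemma tauN x : tau q (- x) = - tau q x.
Proof. by apply: (addIr (tau q x)); rewrite -tauD !addNr tau0. Qed.

Lemma tau_inj : injective (tau q : Q -> Q).
Proof.
move=> x y E; apply/eqP; rewrite -subr_eq0 -tau_eq0 tauD tauN E.
by rewrite subrr.
Qed.

Lemma tauX x n : tau q (x ^+ n) = tau q x ^+ n.
Proof. by elim: n => [|n IH]; rewrite ?tau1 // !exprS tauM IH. Qed.

Lemma tau_scalar z : tau q (scalar_op z) = scalar_op z :> Q.
Proof.
rewrite -[scalar_op z]/(inC (contC_cst z) / inC (contC_cst 1)).
rewrite tau_frac ?contC_cst1_neq0 // (dil_cst _ z q0) (dil_cst _ 1 q0).
move: (contC_cst z) (contC_cst 1) => f g; rewrite -!scalar_inC.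
rewrite -mulf_div divff ?mul1r // scalar_eq0.
by rewrite fmorph_eq0 gt_eqF.
Qed.

(** Both ramps in [translE] acquire the same factor $q^2$, which cancels. *)
Lemma tau_transl (lambda : R) : 0 <= lambda ->
  tau q (transl lambda) = transl (lambda / q) :> Q.
Proof.
move=> l0; rewrite !translE tau_frac ?int_step0_neq0 // !dil_int_step //.
rewrite (mul0r q^-1); move: (int_step _) (int_step 0) => f g.
rewrite -!scalar_inC -mulf_div divff ?mul1r // scalar_eq0.
by rewrite fmorph_eq0 expf_neq0 // gt_eqF.
Qed.

End Tau.

(** * The derivation $d/ds$ on $Q(\mathcal{C})$ *)

Lemma dds_inC f : dds (inC f) = inC (mulNt f) :> Q.
Proof.
have c0 := @contC_cst1_neq0 R.
have c0' : inC (contC_cst 1) != 0 :> Q by rewrite inC_eq0.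
have -> : inC f = inC (convol f (contC_cst 1)) / inC (contC_cst 1) :> Q.
  by rewrite inCM mulfK.
move: (contC_cst 1) c0 c0' => c c0 c0'.
rewrite dds_frac // mulNtM; move: (mulNt f) (mulNt c) => f' c'.
by rewrite inCD !inCM; field.
Qed.

Lemma ddsD : {morph (dds : Q -> Q) : x y / x + y}.
Proof.
exact: (@quotient_ruleD Q _ inC convol mulNt dds
  inCD inCM inC_eq0 mulNtD mulNtM dds_frac inC_frac).
Qed.

Lemma ddsM x y : dds (x * y) = dds x * y + x * dds y.
Proof.
exact: (@quotient_ruleM Q _ inC convol mulNt dds
  inCD inCM inC_eq0 mulNtM dds_frac inC_frac).
Qed.

Lemma dds_scalar z : dds (scalar_op z) = 0 :> Q.
Proof.
rewrite /scalar_op dds_frac ?contC_cst1_neq0 //.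
rewrite -(inCM (mulNt _)) -(inCM _ (mulNt _)) -inCB.
(* The numerator of the quotient rule vanishes: in $\{-tz\}\{1\}=\{z\}\{-t\}$ the scalar only
   changes factor. *)
suff -> : convol (mulNt (contC_cst z)) (contC_cst 1) =
    convol (contC_cst z) (mulNt (contC_cst 1)) by rewrite subrr inC0 mul0r.
rewrite (convol_cst z) convolC; congr (convol _ _).
apply: contC_eq => t t0; have E w : mulNt (contC_cst w) t = - t%:C * w.
  by rewrite mulNtE // contC_cstE.
by rewrite [RHS]contC_scaleE !E mulr1 mulrC.
Qed.

Lemma dds_transl (lambda : R) : 0 <= lambda ->
  dds (transl lambda) = - scalar_op lambda%:C * transl lambda :> Q.
Proof.
move=> l0; have J0 := int_step0_neq0; have i00 := @int_step00 R.
(* (d/ds) l^2 = l^2 * (- 2 l), and (d/ds) h^lambda l^2 follows by translation. *)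
have [k mE] : exists k, mulNt (int_step 0) = convol (int_step 0) k :> contC R.
  exists (- (contC_cst 1 + contC_cst 1)); rewrite -[in LHS]convol_cst1 mulNtM mulNt_cst1.
  move: (int_step 0) (contC_cst 1) => J c.
  by rewrite (convolC (- J)) !convolNr convolDr (convolC J) opprD.
have mlE : inC (mulNt (int_step lambda)) = inC (int_step lambda) * inC k -
    scalar_op lambda%:C * inC (int_step lambda) :> Q.
  rewrite [in LHS]int_step_delay // mulNt_delay // mE.
  rewrite -(convol_delay _ _ _ l0 i00) -int_step_delay //.
  by rewrite inCB inCM scalar_inC.
(* Both ramps have the term [k] in their logarithmic derivative, so it cancels and only $-\lambda$
   survives. *)
rewrite translE dds_frac // mlE mE (inCM (int_step 0) k).
move: (int_step 0) J0 (int_step lambda) => J J0 f; field.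
by rewrite inC_eq0.
Qed.

(** * Limits in $Q(\mathcal{C})$ *)

Lemma QcvgP u x : Qcvg u x <-> exists p (f_ : nat -> contC R) f,
  [/\ p != 0, forall n, u n = p * inC (f_ n), ucvg f_ f & x = p * inC f].
Proof.
split=> -[p [f_ [f [p0 uE cf ->]]]]; exists p, f_, f; split=> // n.
  by rewrite -uE mulrC divfK.
by rewrite uE mulrAC divff // mul1r.
Qed.

(** With $p=a/b$ and $p'=c/d$, clearing denominators gives $ad\,f_n=cb\,g_n$ in $\mathcal{C}$.
    Convolution is continuous, so $ad\,f=cb\,g$ by uniqueness of locally uniform limits. *)
Lemma Qcvg_unique u x y : Qcvg u x -> Qcvg u y -> x = y.
Proof.
move=> /QcvgP[p [f_ [f [p0 uf cf ->]]]] /QcvgP[p' [g_ [g [p'0 ug cg ->]]]].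
have [a [b [b0 pE]]] := inC_frac p; have [c [d [d0 p'E]]] := inC_frac p'.
have B0 : inC b != 0 :> Q by rewrite inC_eq0.
have D0 : inC d != 0 :> Q by rewrite inC_eq0.
suff E : convol (convol a d) f = convol (convol c b) g.
  apply: (mulIf (mulf_neq0 B0 D0)); rewrite pE p'E.
  transitivity (inC (convol (convol a d) f) : Q).
    by rewrite !inCM; field.
  by rewrite E !inCM; field.
apply: ucvg_unique (ucvg_convol _ _ _ cf) _.
rewrite (_ : (fun n => _) = (fun n => convol (convol c b) (g_ n))).
  exact: ucvg_convol.
apply/funext => n; apply: (@inC_inj _ Q).
have : p * inC (f_ n) = p' * inC (g_ n) by rewrite -uf ug.
move=> /(congr1 (fun z => z * (inC b * inC d))); rewrite pE p'E !inCM => E.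
transitivity (inC a / inC b * inC (f_ n) * (inC b * inC d) : Q); first by field.
by rewrite E; field.
Qed.

Lemma Qcvg_mull c u x : c != 0 -> Qcvg u x -> Qcvg (fun n => c * u n) (c * x).
Proof.
move=> c0 /QcvgP[p [f_ [f [p0 uE cf ->]]]]; apply/QcvgP; exists (c * p), f_, f.
by split=> [|n||]; rewrite ?mulf_neq0 // ?uE mulrA.
Qed.

Lemma Qcvg_reindex (phi : nat -> nat) u x :
  phi n @[n --> \oo] --> \oo -> Qcvg u x -> Qcvg (u \o phi) x.
Proof.
move=> cphi /QcvgP[p [f_ [f [p0 uE cf ->]]]]; apply/QcvgP.
exists p, (f_ \o phi), f; split=> // [n|]; first exact: uE.
exact: ucvg_reindex.
Qed.

Lemma Qcvg_tau (q : R) u x : 0 < q -> Qcvg u x ->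
  Qcvg (fun n => tau q (u n)) (tau q x).
Proof.
move=> q0 /QcvgP[p [f_ [f [p0 uE cf ->]]]]; apply/QcvgP.
exists (tau q p), (fun n => dil q (f_ n)), (dil q f); split.
- by rewrite tau_eq0.
- by move=> n; rewrite uE tauM // tau_inC.
- exact: ucvg_dil.
- by rewrite tauM // tau_inC.
Qed.

Lemma Qcvg_dds u x : Qcvg u x -> Qcvg (fun n => dds (u n)) (dds x).
Proof.
move=> /QcvgP[p [f_ [f [p0 uE cf ->]]]]; apply/QcvgP.
have [a [b [b0 pE]]] := inC_frac p; have [c [d [d0 p'E]]] := inC_frac (dds p).
have B0 : inC b != 0 :> Q by rewrite inC_eq0.
have D0 : inC d != 0 :> Q by rewrite inC_eq0.
(* A common denominator of p and dds p makes dds a continuous operator of C. *)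
have ddsE g : dds (p * inC g) = (inC b * inC d)^-1 *
    inC (convol (convol c b) g + convol (convol a d) (mulNt g)).
  rewrite ddsM dds_inC p'E pE; move: (mulNt g) => g'.
  by rewrite inCD !inCM; field; rewrite B0 D0.
exists (inC b * inC d)^-1.
exists (fun n => convol (convol c b) (f_ n) + convol (convol a d) (mulNt (f_ n))).
exists (convol (convol c b) f + convol (convol a d) (mulNt f)); split.
- by rewrite invr_neq0 // mulf_neq0.
- by move=> n; rewrite uE.
- by apply: ucvgD; apply: ucvg_convol => //; exact: ucvg_mulNt.
- exact: ddsE.
Qed.

End FractionField.

(** * Power series in $h$ and their product *)

Section PowerSeries.
Context {R : realType} {Q : fraction_field R}.
Implicit Types (alpha beta : nat -> R[i]) (P : {poly R[i]}) (t : R) (x : Q).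

(** The partial sum of the series in $h$ multiplied by $l^2$, which brings it into [contC]; see
    [partial_series_inC]. *)
Definition partial_series alpha N : contC R :=
  \sum_(0 <= n < N) contC_scale (alpha n) (int_step n%:R).

Lemma partial_seriesE alpha N t :
  partial_series alpha N t = \sum_(0 <= n < N) alpha n * int_step n%:R t.
Proof.
rewrite /partial_series (big_morph (fun f : contC R => f t) (id1 := 0) (op1 := +%R)) //.
by apply: eq_bigr => n _; exact: contC_scaleE.
Qed.

Lemma int_step_le (lambda t : R) : 0 <= lambda -> t <= lambda ->
  int_step lambda t = 0.
Proof.
move=> l0 tl; have [t0|/contC_lt0->//] := leP 0 t.
by rewrite int_step_max // max_l // subr_le0.
Qed.

(** The ramps of index at least [N] vanish at every point $t\le N$. *)
Lemma eq_partial_series alpha beta N M M' t :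
    (forall n, (n < N)%N -> alpha n = beta n) -> t <= N%:R ->
    (N <= M)%N -> (N <= M')%N ->
  partial_series alpha M t = partial_series beta M' t.
Proof.
move=> ab tN.
have cut (gam : nat -> R[i]) K : (N <= K)%N ->
    partial_series gam K t = \sum_(0 <= n < N) gam n * int_step n%:R t.
  move=> NK; rewrite partial_seriesE (big_cat_nat (leq0n N) NK) /= [X in _ + X]big_nat_cond.
  rewrite [X in _ + X]big1 ?addr0 // => n; rewrite andbT => /andP[Nn _].
  by rewrite int_step_le ?mulr0 // (le_trans tN) // ler_nat.
move=> NM NM'; rewrite !cut //; apply: eq_big_nat => n /andP[_ nN].
by rewrite ab.
Qed.

(** $l^2$ times the whole series: since $t<\lfloor t\rfloor+1$, the later ramps vanish at $t$. *)
Definition Cseries alpha : contC R :=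
  Cfun (fun t => partial_series alpha (Num.truncn t).+1 t).

Lemma CseriesE alpha N t : t <= N%:R -> Cseries alpha t = partial_series alpha N t.
Proof.
have key K s : 0 <= s -> s <= K%:R ->
    partial_series alpha (Num.truncn s).+1 s = partial_series alpha K s.
  move=> s0 sK.
  have sT : s <= (Num.truncn s).+1%:R by rewrite ltW // truncnS_gt.
  have [KT|TK] := leqP K (Num.truncn s).+1.
    exact: (eq_partial_series _ _ K).
  by apply: (eq_partial_series _ _ (Num.truncn s).+1) => //; exact: ltnW.
move=> tN; have [t0|t0] := leP 0 t; last by rewrite !contC_lt0.
rewrite CfunE // ?(key N) //.
pose H s := partial_series alpha (Num.truncn (Num.max 0 s)).+1 (Num.max 0 s).
suff cH : continuous H.
  refine (subspace_eq_continuous _ (continuous_subspaceT cH)) => s /set_mem /=.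
  by rewrite in_itv /= andbT => s0; rewrite /from_subspace /H max_r.
(* [K] exceeds the clamped [s] strictly, so near [s] the function [H] is a partial sum of fixed
   length [K], which is continuous. *)
move=> s; pose K := (Num.truncn (Num.max 0 s)).+1.
have M0 (r : R) : 0 <= Num.max 0 r by rewrite le_max lexx.
have sK : Num.max 0 s < K%:R by exact: truncnS_gt.
have HsE : H s = partial_series alpha K (Num.max 0 s) by exact/key/ltW.
rewrite /continuous_at HsE.
apply: cvg_trans (contC_ext_continuous (partial_series alpha K) s).
apply: near_eq_cvg; near=> r; rewrite /H (key K) //.
rewrite ge_max ler0n /=.
near: r; apply: (@lt_le_nbhsl R).
by apply: le_lt_trans sK; rewrite le_max lexx orbT.
Unshelve. all: by end_near. Qed.

Lemma ucvg_Cseries alpha : ucvg (partial_series alpha) (Cseries alpha).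
Proof.
apply: ucvg_near => T; near=> n => t /andP[t0 tT].
rewrite (CseriesE _ n) //; apply: le_trans tT _.
near: n; exact: nbhs_infty_ger.
Unshelve. all: by end_near. Qed.

Lemma partial_series_inC alpha N :
  \sum_(0 <= n < N) scalar_op (alpha n) * transl 1 ^+ n =
  inC (partial_series alpha N) / inC (int_step 0) :> Q.
Proof.
rewrite /partial_series (big_morph inC inCD inC0) mulr_suml.
apply: eq_bigr => n _; rewrite translX // translE mulrA.
by congr (_ / _); exact: scalar_inC.
Qed.

Lemma inC_int_step0_neq0 : inC (int_step 0) != 0 :> Q.
Proof. by rewrite inC_eq0; exact: (@int_step0_neq0 _ Q). Qed.

Lemma Qsum_Cseries alpha x :
  Qsum 0 (fun n => scalar_op (alpha n) * transl 1 ^+ n) x <->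
  x = inC (Cseries alpha) / inC (int_step 0).
Proof.
suff H : Qsum 0 (fun n => scalar_op (alpha n) * transl 1 ^+ n)
    (inC (Cseries alpha) / inC (int_step 0) : Q).
  by split=> [Hx|->//]; exact: Qcvg_unique Hx H.
apply/QcvgP; exists (inC (int_step 0))^-1, (partial_series alpha), (Cseries alpha).
split; first by rewrite invr_neq0 // inC_int_step0_neq0.
- by move=> N; rewrite partial_series_inC mulrC.
- exact: ucvg_Cseries.
- by rewrite mulrC.
Qed.

Lemma series_ringP x : series_ring Q x <->
  exists alpha, x = inC (Cseries alpha) / inC (int_step 0).
Proof. by split=> -[a /Qsum_Cseries H]; exists a. Qed.

Definition horner_transl P : Q := (map_poly scalar_op P).[transl 1].

Lemma partial_series_poly P N : (size P <= N)%N ->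
  inC (partial_series (fun n => P`_n) N) = inC (int_step 0) * horner_transl P.
Proof.
move=> PN; rewrite /horner_transl (@horner_coef_wide _ N) ?size_map_poly //.
rewrite mulrC; apply: (canRL (mulfVK inC_int_step0_neq0)).
rewrite -partial_series_inC big_mkord; apply: eq_bigr => n _.
by rewrite coef_map.
Qed.

Lemma Cseries_poly P : inC (Cseries (fun n => P`_n)) = inC (int_step 0) * horner_transl P.
Proof.
rewrite -(@partial_series_poly P (size P)) //; congr inC; apply: contC_eq => t t0.
(* Enough terms to exhaust the coefficients of [P] and to reach beyond [t]. *)
have tT : t <= (maxn (size P) (Num.truncn t).+1)%:R.
  by rewrite (le_trans (ltW (truncnS_gt t))) // ler_nat leq_maxr.
rewrite (CseriesE _ _ _ tT) !partial_seriesE.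
rewrite (big_cat_nat (leq0n _) (leq_maxl (size P) (Num.truncn t).+1)) //=.
rewrite [X in _ + X]big_nat_cond [X in _ + X]big1 ?addr0 // => n.
by rewrite andbT => /andP[Pn _]; rewrite nth_default // mul0r.
Qed.

(** The Cauchy product formula multiplied by $l^4$. On $[0,t]$ all series become polynomials, and
    evaluation of polynomials at $h$ is multiplicative. *)
Lemma CseriesM alpha beta : convol (Cseries alpha) (Cseries beta) =
  convol (int_step 0)
    (Cseries (fun n => \sum_(i < n.+1) alpha i * beta (n - i)%N)).
Proof.
apply: contC_eq => t t0; pose N := (Num.truncn t).+1.
have tN u : 0 <= u <= t -> u <= N%:R.
  by move=> /andP[_ ut]; rewrite (le_trans ut) // ltW // truncnS_gt.
pose A := \poly_(i < N) alpha i; pose B := \poly_(i < N) beta i.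
have AN : (size A <= N)%N by exact: size_poly.
have BN : (size B <= N)%N by exact: size_poly.
transitivity (convol (partial_series (fun n => A`_n) N) (partial_series (fun n => B`_n) N) t).
  apply: eq_convol => // u /tN uN; rewrite (CseriesE _ _ _ uN);
  by apply: (eq_partial_series _ _ N) => // n nN; rewrite coef_poly nN.
have -> : convol (partial_series (fun n => A`_n) N) (partial_series (fun n => B`_n) N) =
    convol (int_step 0) (partial_series (fun n => (A * B)`_n) (N + N)).
  (* Length [N + N] retains every coefficient of [A * B], so the identity is exact in [Q]. *)
  have ABN : (size (A * B)%R <= N + N)%N.
    by rewrite (leq_trans (size_polyMleq _ _)) // (leq_trans (leq_pred _)) // leq_add.
  apply: (@inC_inj _ Q); apply: etrans (inCM _ _) (etrans _ (esym (inCM _ _))).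
  rewrite (partial_series_poly _ _ AN) (partial_series_poly _ _ BN) (partial_series_poly _ _ ABN).
  by rewrite /horner_transl rmorphM hornerM mulrACA !mulrA.
apply: eq_convol => // u /tN uN; rewrite (CseriesE _ _ _ uN).
apply: (eq_partial_series _ _ N) => // [n nN|]; last exact: leq_addr.
(* For $n<N$ the indices $i$ and $n-i$ are below [N], so truncation does not alter these
   coefficients. *)
rewrite coefM; apply: eq_bigr => i _; rewrite !coef_poly.
by rewrite (leq_ltn_trans _ nN) ?(leq_ltn_trans (leq_subr _ _) nN) // -ltnS.
Qed.

Lemma series_ring_closed : subring_closed [in series_ring Q].
Proof.
split; rewrite ?in_setE.
- apply/series_ringP; exists (fun n => (1 : {poly R[i]})`_n).
  by rewrite Cseries_poly /horner_transl rmorph1 hornerC mulr1 divff // inC_int_step0_neq0.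
- move=> x y; rewrite !in_setE => /series_ringP[a ->] /series_ringP[b ->].
  apply/series_ringP; exists (fun n => a n - b n).
  rewrite -mulrBl -inCB; congr (inC _ / _); apply: contC_eq => t t0.
  have tT := ltW (truncnS_gt t); rewrite -[LHS]/(Cseries a t - Cseries b t).
  rewrite !(CseriesE _ _ _ tT) !partial_seriesE -sumrB.
  by apply: eq_bigr => n _; rewrite mulrBl.
- move=> x y; rewrite !in_setE => /series_ringP[a ->] /series_ringP[b ->].
  apply/series_ringP.
  exists (fun n => \sum_(i < n.+1) a i * b (n - i)%N).
  rewrite mulf_div -inCM CseriesM (inCM (int_step 0)).
  by rewrite -mulf_div divff ?mul1r // inC_int_step0_neq0.
Qed.

(** * The action of $\tau_{1/m}$ and $-h^{-1}\frac{d}{ds}$ on power series *)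

Lemma tau_Qsum (m : nat) alpha x : (0 < m)%N ->
  Qsum 0 (fun n => scalar_op (alpha n) * transl 1 ^+ n) x ->
  Qsum 0 (fun n => scalar_op (alpha n) * transl 1 ^+ (m * n))
    (tau m%:R^-1 x).
Proof.
move=> m0; have q0 : 0 < m%:R^-1 :> R by rewrite invr_gt0 ltr0n.
move=> /(Qcvg_tau _ _ _ q0); congr (Qcvg _ _); apply/funext => N.
rewrite (big_morph _ (tauD _ q0) (tau0 _ q0)); apply: eq_bigr => n _.
by rewrite tauM // tau_scalar // tauX // tau_transl // mul1r invrK -translX // exprM.
Qed.

(** For [n = 0] the exponent [n.-1] is 0 by convention, and the factor [n%:R] makes the term
    vanish. *)
Lemma dds_transl1X n :
  dds (transl 1 ^+ n) = - transl 1 * (n%:R * transl 1 ^+ n.-1) :> Q.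
Proof.
elim: n => [|n IH].
  by rewrite expr0 mul0r mulr0 -[1](rmorph1 scalar_op) dds_scalar.
rewrite exprS ddsM IH dds_transl // rmorph1 /=.
case: n {IH} => [|n]; first by rewrite expr0; ring.
by rewrite exprS [n.+2%:R]mulrS; ring.
Qed.

Lemma dds_Qsum alpha x :
  Qsum 0 (fun n => scalar_op (alpha n) * transl 1 ^+ n) x ->
  Qsum 1 (fun n => scalar_op (n%:R * alpha n) * transl 1 ^+ n.-1)
    (- (transl 1)^-1 * dds x).
Proof.
have h0 := @transl_neq0 _ Q 1 ler01.
move=> /Qcvg_dds/(Qcvg_mull (- (transl 1)^-1)).
rewrite oppr_eq0 invr_eq0 => /(_ h0); congr (Qcvg _ _); apply/funext => N.
have dds0 : dds 0 = 0 :> Q by rewrite -(rmorph0 scalar_op) dds_scalar rmorph0.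
rewrite (big_morph _ ddsD dds0) mulr_sumr.
transitivity (\sum_(0 <= n < N)
    scalar_op (n%:R * alpha n) * transl 1 ^+ n.-1 : Q).
  apply: eq_bigr => n _; rewrite ddsM dds_scalar dds_transl1X.
  by rewrite rmorphM rmorph_nat; field.
(* The term of index 0 carries the factor 0, so the sum may start at 1. *)
case: N => [|N]; first by rewrite !big_geq.
by rewrite big_ltn // mul0r rmorph0 mul0r add0r.
Qed.

Lemma series_ring_tau (m : nat) x : (0 < m)%N ->
  series_ring Q x -> series_ring Q (tau m%:R^-1 x).
Proof.
move=> m0 [alpha] /(tau_Qsum _ _ _ m0) Hx.
(* The coefficients of $\sum_n\alpha_nh^{mn}$ as a power series in $h$; its partial sums of length
   [N * m] are the [N]-term sums of the sparse series. *)
pose beta k := if (m %| k)%N then alpha (k %/ m)%N else 0.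
pose y : Q := inC (Cseries beta) / inC (int_step 0).
have Hy : Qsum 0 (fun n => scalar_op (beta n) * transl 1 ^+ n) y.
  exact/Qsum_Cseries.
suff -> : tau m%:R^-1 x = y by exists beta.
apply: Qcvg_unique Hx _.
have cm : (N * m)%N @[N --> \oo] --> \oo.
  apply/cvgnyPge => A; near=> N; rewrite (@leq_trans N) ?leq_pmulr //.
  by near: N; exact: nbhs_infty_ge.
have := Qcvg_reindex _ _ _ cm Hy; congr (Qcvg _ _); apply/funext => N /=.
elim: N => [|N IH]; first by rewrite mul0n !big_geq.
(* Among the [m] new indices only the first, [N * m], is a multiple of [m]. *)
rewrite big_nat_recr //= -IH (big_cat_nat (n := N * m)) ?leq_mul2r ?leqnSn ?orbT //=.
congr (_ + _); rewrite big_ltn; last by rewrite mulSn -{1}[(N * m)%N]add0n ltn_add2r.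
rewrite /beta dvdn_mull // mulnK // mulnC big_nat_cond big1 ?addr0 //.
move=> k; rewrite andbT => /andP[Nk kN].
case: ifP => [/dvdnP[j kE]|_]; last by rewrite rmorph0 mul0r.
by move: Nk kN; rewrite kE (mulnC m) !ltn_pmul2r // => Nj; rewrite ltnNge Nj.
Unshelve. all: by end_near. Qed.

Lemma series_ring_dds x : series_ring Q x ->
  series_ring Q (- (transl 1)^-1 * dds x).
Proof.
move=> [alpha] /dds_Qsum Hx; exists (fun n => n.+1%:R * alpha n.+1).
(* Partial sums over $1\le n<N+1$ become, after an index shift, those over $0\le n<N$. *)
have cS : N.+1 @[N --> \oo] --> \oo.
  by apply/cvgnyPge => A; near=> N; rewrite leqW //; near: N; exact: nbhs_infty_ge.
have := Qcvg_reindex _ _ _ cS Hx; congr (Qcvg _ _); apply/funext => N /=.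
by rewrite big_add1.
Unshelve. all: by end_near. Qed.

End PowerSeries.

(** * Passage from a DT subring to its quotient field *)

Section Quotients.
Variables (K : fieldType) (D sigma : K -> K) (S : set K).

Lemma quotients_DT_subfield :
  DT_subring D sigma S -> DT_subfield D sigma (quotients S).
Proof.
move=> [DT [S1 SB SM] SD Ssg]; have [DD DM sgD sgM sg1 sgI] := DT.
have {}S1 : S 1 by move: S1; rewrite in_setE.
have {}SB x y : S x -> S y -> S (x - y).
  by move=> Sx Sy; have := SB x y; rewrite !in_setE; exact.
have {}SM x y : S x -> S y -> S (x * y).
  by move=> Sx Sy; have := SM x y; rewrite !in_setE; exact.
have S0 : S 0 by rewrite -(subrr 1); exact: SB.
have sg0 : sigma 0 = 0 by apply: (addIr (sigma 0)); rewrite -sgD !add0r.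
split=> //.
- split; rewrite ?in_setE.
  + by exists 1, 1; split=> //; rewrite ?oner_neq0 ?divr1.
  + move=> x y; rewrite !in_setE => -[a [b [Sa Sb b0 ->]]] [c [d [Sc Sd d0 ->]]].
    exists (a * d - c * b), (b * d); split; rewrite ?mulf_neq0 //.
    * by apply: SB; exact: SM.
    * exact: SM.
    * by field; rewrite b0 d0.
  + move=> x y; rewrite !in_setE => -[a [b [Sa Sb b0 ->]]] [c [d [Sc Sd d0 ->]]].
    (* Division by 0 yields 0, which is represented as $0/1$. *)
    have [->|c0] := eqVneq c 0.
      by exists 0, 1; rewrite oner_neq0 !mul0r invr0 mulr0.
    exists (a * d), (b * c); split; rewrite ?mulf_neq0 //; [exact: SM..|].
    by field; rewrite b0 c0 d0.
- move=> _ [a [b [Sa Sb b0 ->]]].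
  exists (D a * b - a * D b), (b * b); split; rewrite ?mulf_neq0 //.
  + by apply: SB; apply: SM => //; exact: SD.
  + exact: SM.
  (* The quotient rule follows from the Leibniz rule for the product $(a/b)\,b=a$. *)
  + have := DM (a / b) b; rewrite divfK // => ->.
    by field.
- move=> _ [a [b [Sa Sb b0 ->]]].
  have sb0 : sigma b != 0 by rewrite -sg0 (inj_eq sgI).
  exists (sigma a), (sigma b); split=> //; [exact: Ssg..|].
  by apply: (canRL (mulfK sb0)); rewrite -sgM divfK.
Qed.

End Quotients.

Theorem theorem5p4 (R : realType) (Q : fraction_field R)
    (d : int) (d_gt1 : 1 < d) :
  let sigma_d : Q -> Q := tau (d%:~R^-1) in
  let h : Q := transl 1 in
  let D' : Q -> Q := fun x => - h^-1 * dds x in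
  [/\ forall alpha : nat -> R[i], exists x : Q,
        Qsum 0 (fun n => scalar_op (alpha n) * h ^+ n) x,
      forall (alpha : nat -> R[i]) (x : Q),
        Qsum 0 (fun n => scalar_op (alpha n) * h ^+ n) x ->
        Qsum 0 (fun n => scalar_op (alpha n) * h ^ (d * n%:Z)) (sigma_d x) /\
        Qsum 1 (fun n => scalar_op (n%:R * alpha n) * h ^+ n.-1) (D' x),
      DT_subring D' sigma_d (series_ring Q)
    & DT_subfield D' sigma_d (quotients (series_ring Q))].
Proof.
(* A negative [d] contradicts $1<d$, so [d] is a natural number [m] and the powers $h^{dn}$ have
   natural exponents. *)
case: d d_gt1 => [m m1|//]; rewrite -pmulrn.
have m0 : (0 < m)%N by apply: ltnW; rewrite -ltz_nat.
have q0 : 0 < m%:R^-1 :> R by rewrite invr_gt0 ltr0n.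
move=> sigma_d h D'.
have DTS : DT_subring D' sigma_d (series_ring Q).
  split.
  - split.
    + by move=> x y; rewrite /D' ddsD mulrDr.
    + by move=> x y; rewrite /D' ddsM; ring.
    + exact: tauD.
    + exact: tauM.
    + exact: tau1.
    + exact: tau_inj.
  - exact: series_ring_closed.
  - exact: series_ring_dds.
  - by move=> x; exact: series_ring_tau.
split=> //; last exact: quotients_DT_subfield.
- move=> alpha; exists (inC (Cseries alpha) / inC (int_step 0)).
  exact/Qsum_Cseries.
- move=> alpha x Hx; split; last exact: dds_Qsum.
  exact: tau_Qsum.
Qed.
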